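(* A topological semigroup $S$ is a continuous homomorphic image of a compact Clifford semigroup $S_0\in\mathcal H_0$ if and only if $S$ is a compact Clifford topological inverse semigroup with Lawson idempotent semilattice.
   Context: A topological semigroup is a topological space endowed with a continuous semigroup operation. Topological groups are Tychonoff. A topological semigroup $S_1$ embeds into a topological semigroup $S_2$ if there is a semigroup homomorphism $S_1\to S_2$ that is a topological embedding. Products carry the Tychonoff topology and the coordinatewise operation. $S$ is a continuous homomorphic image of $S_0$ if there is a continuous surjective semigroup homomorphism $S_0\to S$. For a topological group $G$, $\exp(G)$ is the semigroup of all non-empty compact subsets of $G$ with the operation $AB=\{ab:a\in A,\ b\in B\}$ and the Vietoris topology, generated by the sub-base of sets $U^+=\{K\in\exp(G):K\subset U\}$ and $U^-=\{K\in\exp(G):K\cap U\neq\emptyset\}$, $U$ open in $G$. $\mathcal H$ is the class of all topological semigroups that embed into $\exp(G)$ for some topological group $G$. $\mathcal H_0$ is the smallest class of topological semigroups closed under subdirect products, semidirect products with Abelian topological groups, and attaching zero to compact semigroups from $\mathcal H$. Here: a topological semigroup $T$ is a subdirect product of a family $\{S_\alpha:\alpha\in A\}$ of topological semigroups if $T$ embeds into $\prod_{\alpha\in A}S_\alpha$; if $\sigma$ is a homomorphism from a topological group $G$ to the group of topological automorphisms of a topological semigroup $T$ such that the map $G\times T\to T$, $(g,t)\mapsto\sigma(g)(t)$, is continuous, then the semidirect product of $T$ with $G$ is the space $T\times G$ with the operation $(t,g)*(t',g')=(t\cdot\sigma(g)(t'),gg')$; attaching zero to $T$ means passing to $T^0=T\cup\{0\}$,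 the extension of $T$ by an isolated point $0\notin T$ such that $t0=0t=0$ for all $t\in T^0$. A semigroup is Clifford if each of its elements lies in a subgroup. A semigroup $T$ is inverse if for each $x\in T$ there is a unique $x^{-1}\in T$ with $xx^{-1}x=x$ and $x^{-1}xx^{-1}=x^{-1}$; then the idempotents of $T$ form a commutative subsemigroup, called the idempotent semilattice of $T$. A topological inverse semigroup is a topological semigroup that is inverse and whose inversion $x\mapsto x^{-1}$ is continuous. A topological semilattice $E$ is Lawson if open subsemilattices form a base of the topology of $E$.
   Formalization: The topological semigroup S is assumed Hausdorff; without this the ''if'' part fails, e.g. for the integers with the indiscrete topology, which are not a homomorphic image of any compact Clifford semigroup in H_0. *)

(* Defs.v *)
From HB Require Import structures.
From mathcomp Require Import all_boot finmap.
From mathcomp Require Import all_classical all_reals all_analysis.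

Set Implicit Arguments.
Unset Strict Implicit.
Unset Printing Implicit Defensive.

Local Open Scope classical_set_scope.
Local Open Scope group_scope.

(* No separation axiom is part of [topSemigroupType]: where spaces are meant to
   be Hausdorff this is an explicit hypothesis. *)
HB.mixin Record Semigroup_isTopSemigroup S of Topological S & Semigroup S := {
  mulg_continuous : continuous (fun p : (S * S)%type => p.1 * p.2)
}.

#[short(type="topSemigroupType")]
HB.structure Definition TopSemigroup :=
  {S of Topological S & Semigroup S & Semigroup_isTopSemigroup S}.

(* Topological groups are Tychonoff, i.e. completely regular and Hausdorff. *)
HB.mixin Record TopSemigroup_isTopGroup G of TopSemigroup G & Group G := {
  invg_continuous : continuous (fun x : G => x^-1);
  topgroup_completely_regular : completely_regular_space G;
  topgroup_hausdorff : hausdorff_space G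
}.

#[short(type="topGroupType")]
HB.structure Definition TopGroup :=
  {G of TopSemigroup G & Group G & TopSemigroup_isTopGroup G}.

Definition semigroup_hom (S T : topSemigroupType) (f : S -> T) : Prop :=
  forall x y, f (x * y) = f x * f y.

Definition topological_embedding (X Y : topologicalType) (f : X -> Y) : Prop :=
  injective f /\
  forall U : set X, open U <-> exists2 V : set Y, open V & U = f @^-1` V.

Definition embeds (S T : topSemigroupType) : Prop :=
  exists2 f : S -> T, semigroup_hom f & topological_embedding f.

Definition continuous_hom_image (S0 S : topSemigroupType) : Prop :=
  exists f : S0 -> S,
    [/\ semigroup_hom f, continuous f & range f = [set: S]].

Lemma compact_prod_nbhs (X Y : topologicalType) (K : set X) (L : set Y)
    (O : set (X * Y)) :
  compact K -> compact L -> L !=set0 ->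
  (forall x y, K x -> L y -> nbhs (x, y) O) ->
  exists V W, [/\ set_nbhs K V, set_nbhs L W & V `*` W `<=` O].
Proof.
move=> /compact_near_coveringP cK /compact_near_coveringP cL L0 KLO.
have step1 x : K x ->
    exists2 V, nbhs x V & set_nbhs L [set y | forall x', V x' -> O (x', y)].
  move=> Kx.
  pose P (V : set X) (y : Y) := nbhs y [set y' | forall x', V x' -> O (x', y')].
  have [y Ly|M [MV _ [V MV0]] sM] := cL _ (powerset_filter_from (nbhs x)) P _.
    have [[A B] /= [Ax By] ABO] := KLO _ _ Kx Ly.
    exists (interior B, [set V | V `<=` A]).
      by split; [exact: nbhs_interior|exact: small_set_sub].
    move=> [y' V] /= [By' VA]; apply: filterS By' => y'' By'' x' /VA Ax'.
    exact: ABO.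
  by exists V; [exact: MV|move=> y Ly; exact: (sM _ MV0)].
have FL := set_nbhs_pfilter L0.
pose P (W : set Y) (x : X) := nbhs x [set x' | forall y, W y -> O (x', y)].
have [x Kx|M [MW _ [W MW0]] sM] := cK _ (powerset_filter_from (set_nbhs L)) P _.
  have [V xV LV] := step1 x Kx.
  exists (interior V, [set W | W `<=` [set y | forall x', V x' -> O (x', y)]]).
    by split; [exact: nbhs_interior|exact: small_set_sub].
  move=> [x' W] /= [Vx' WV]; apply: filterS Vx' => x'' Vx'' y /WV.
  exact.
exists [set x | forall y, W y -> O (x, y)], W; split=> [x Kx||[x y] [/= + Wy]].
- exact: (sM _ MW0).
- exact: MW.
- exact.
Qed.

Section Hyperspace.
Variable G : topGroupType.

Definition nonempty_compacts : set (set G) := [set K | K !=set0 /\ compact K].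

Definition hyperspace : Type := set_type nonempty_compacts.

HB.instance Definition _ := Choice.on hyperspace.

Definition hset (K : hyperspace) : set G := set_val K.

Definition vietoris_upper (U : set G) : set hyperspace :=
  [set K | hset K `<=` U].

Definition vietoris_lower (U : set G) : set hyperspace :=
  [set K | hset K `&` U !=set0].

Definition vietoris_subbase : set (set hyperspace) :=
  [set vietoris_upper U | U in open] `|` [set vietoris_lower U | U in open].

HB.instance Definition _ :=
  isSubBaseTopological.Build hyperspace vietoris_subbase id.

Lemma hset_inj : injective hset.
Proof. exact: val_inj. Qed.

Lemma hsetP (K : hyperspace) : nonempty_compacts (hset K).
Proof. exact: set_valP. Qed.

Definition prod_set (A B : set G) : set G := [set a * b | a in A & b in B].

Lemma prod_set_compacts (A B : set G) :
  nonempty_compacts A -> nonempty_compacts B ->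
  nonempty_compacts (prod_set A B).
Proof.
move=> [[a Aa] cA] [[b Bb] cB]; split; first by exists (a * b), a => //; exists b.
have -> : prod_set A B = (fun p : (G * G)%type => p.1 * p.2) @` (A `*` B).
  rewrite eqEsubset; split=> [_ [x Ax [y By <-]]|_ [[x y] [/= Ax By] <-]].
    by exists (x, y).
  by exists x => //; exists y.
apply: continuous_compact; last exact: compact_setX.
by apply: continuous_subspaceT => p; apply: mulg_continuous.
Qed.

Definition hyperspace_mul (A B : hyperspace) : hyperspace :=
  exist _ (prod_set (hset A) (hset B))
    (mem_set (prod_set_compacts (hsetP A) (hsetP B))).

Lemma hyperspace_mulA : associative hyperspace_mul.
Proof.
move=> A B C; apply: hset_inj; rewrite /hset /=.
rewrite eqEsubset; split=> [_ [a Aa [_ [b Bb [c Cc <-]] <-]]|].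
  by rewrite mulgA; exists (a * b); [exists a => //; exists b|exists c].
move=> _ [_ [a Aa [b Bb <-]] [c Cc <-]].
by rewrite -mulgA; exists a => //; exists (b * c) => //; exists b => //; exists c.
Qed.

HB.instance Definition _ := isSemigroup.Build hyperspace hyperspace_mulA.

Lemma vietoris_openP (V : set hyperspace) : vietoris_subbase V -> open V.
Proof.
move=> DV; exists [set V]; last by rewrite bigcup_set1.
move=> _ ->; exists [fset V]%fset => [?|]; first by move=> /fset1P ->; exact: mem_set.
by rewrite set_fset1 bigcap_set1.
Qed.

Lemma vietoris_continuous (X : topologicalType) (f : X -> hyperspace) :
  (forall x V, vietoris_subbase V -> V (f x) -> nbhs x (f @^-1` V)) ->
  continuous f.
Proof.
move=> fV x W; rewrite nbhsE => -[_ [[D' sD' <-] [V D'V Vfx]] sW].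
have [J sJ VE] := sD' _ D'V.
have : nbhs x (f @^-1` V).
  rewrite -VE preimage_bigcap; apply: filter_bigI => i iJ.
  have /set_mem Di := sJ _ iJ.
  by apply: fV => //; move: Vfx; rewrite -VE; exact.
by apply: filterS => y Vfy; apply: sW; exists V.
Qed.


Lemma hyperspace_mul_continuous :
  continuous (fun p : (hyperspace * hyperspace)%type => p.1 * p.2).
Proof.
apply: vietoris_continuous => -[A B] _ [[U oU <-]|[U oU <-]].
  move=> ABU; have [_ cA] := hsetP A; have [B0 cB] := hsetP B.
  have [a b Aa Bb|V [W [/set_nbhsP[V' [oV AV VV]] /set_nbhsP[W' [oW BW WW]] VWU]]] :=
      compact_prod_nbhs (O := [set p | U (p.1 * p.2)]) cA cB B0.
    apply: mulg_continuous; apply: open_nbhs_nbhs; split=> //.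
    by apply: ABU; exists a => //; exists b.
  exists (vietoris_upper V', vietoris_upper W').
    split; apply: open_nbhs_nbhs; split=> //; apply: vietoris_openP; left.
      by exists V'.
    by exists W'.
  move=> [A' B'] /= [A'V B'W] _ [a A'a [b B'b <-]].
  by apply: (VWU (a, b)); split; [exact/VV/A'V|exact/WW/B'W].
move=> [_ [[a Aa [b Bb <-]] Uab]].
have : nbhs (a, b) [set p : (G * G)%type | U (p.1 * p.2)].
  by apply: mulg_continuous; apply: open_nbhs_nbhs.
case=> -[V W] /= []; rewrite nbhsE => -[V' [oV V'a VV]].
rewrite nbhsE => -[W' [oW W'b WW]] VWU.
exists (vietoris_lower V', vietoris_lower W').
  split; apply: open_nbhs_nbhs; split.
  - by apply: vietoris_openP; right; exists V'.
  - by exists a.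
  - by apply: vietoris_openP; right; exists W'.
  - by exists b.
move=> [A' B'] /= [[a' [A'a' V'a']] [b' [B'b' W'b']]].
exists (a' * b'); split; first by exists a' => //; exists b'.
by apply: (VWU (a', b')); split; [exact: VV|exact: WW].
Qed.

HB.instance Definition _ :=
  Semigroup_isTopSemigroup.Build hyperspace hyperspace_mul_continuous.

End Hyperspace.

Section Product.
Variables (I : Type) (S : I -> topSemigroupType).

Definition prod_mul (x y : prod_topology S) : prod_topology S :=
  fun i => x i * y i.

Lemma prod_mulA : associative prod_mul.
Proof.
by move=> x y z; apply: functional_extensionality_dep => i; exact: mulgA.
Qed.

HB.instance Definition _ := isSemigroup.Build (prod_topology S) prod_mulA.

Lemma prod_mul_continuous :
  continuous (fun p : (prod_topology S * prod_topology S)%type => p.1 * p.2).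
Proof.
move=> [x y]; apply/cvg_sup => i A [_ [[B oB <-] Bxy] BA].
have pri (z : prod_topology S) U : nbhs (z i) U ->
    nbhs z [set t : prod_topology S | U (t i)].
  rewrite nbhsE => -[V [oV Vz] VU].
  have : nbhs z [set t : prod_topology S | V (t i)].
    have /cvg_sup/(_ i) : z --> z by [].
    by apply; exists [set t : prod_topology S | V (t i)]; split => //; exists V.
  by apply: filterS => t; exact: VU.
have : nbhs (x i, y i) [set p | B (p.1 * p.2)].
  by apply: mulg_continuous; apply: open_nbhs_nbhs.
case=> -[V W] /= [Vx Wy] VWB.
exists ([set t | V (t i)], [set t | W (t i)]).
  by split; exact: pri.
by move=> [s t] /= [Vs Wt]; apply: BA; exact: (VWB (s i, t i)).
Qed.

HB.instance Definition _ :=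
  Semigroup_isTopSemigroup.Build (prod_topology S) prod_mul_continuous.

End Product.

Definition topological_automorphism (T : topSemigroupType) (f : T -> T) : Prop :=
  [/\ semigroup_hom f, continuous f &
      exists g : T -> T, [/\ cancel f g, cancel g f & continuous g]].

(* A homomorphism from [G] to the group of topological automorphisms of [T] with
   continuous evaluation map. *)
Record continuous_action (G : topGroupType) (T : topSemigroupType) := {
  action_fun :> G -> T -> T;
  action_automorphism : forall g, topological_automorphism (action_fun g);
  actionM : forall g h, action_fun (g * h) = action_fun g \o action_fun h;
  action_continuous : continuous (fun p : (G * T)%type => action_fun p.1 p.2)
}.

Definition semidirect (G : topGroupType) (T : topSemigroupType)
  (sigma : continuous_action G T) : Type := (T * G)%type.

Section Semidirect.
Variables (G : topGroupType) (T : topSemigroupType).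
Variable sigma : continuous_action G T.
Local Notation P := (semidirect sigma).

HB.instance Definition _ := Topological.copy P (T * G)%type.

Definition semidirect_mul (x y : P) : P :=
  (x.1 * sigma x.2 y.1, x.2 * y.2).

Lemma semidirect_mulA : associative semidirect_mul.
Proof.
move=> [t g] [u h] [v k]; rewrite /semidirect_mul /=.
have [sM _ _] := action_automorphism sigma g.
by rewrite sM actionM !mulgA.
Qed.

HB.instance Definition _ := isSemigroup.Build P semidirect_mulA.

Lemma semidirect_mul_continuous :
  continuous (fun p : (P * P)%type => p.1 * p.2).
Proof.
move=> p.
have c1 : fst x @[x --> p] --> p.1 by exact: cvg_fst.
have c2 : snd x @[x --> p] --> p.2 by exact: cvg_snd.
have c11 : x.1.1 @[x --> p] --> p.1.1 by apply: cvg_comp c1 _; exact: cvg_fst.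
have c12 : x.1.2 @[x --> p] --> p.1.2 by apply: cvg_comp c1 _; exact: cvg_snd.
have c21 : x.2.1 @[x --> p] --> p.2.1 by apply: cvg_comp c2 _; exact: cvg_fst.
have c22 : x.2.2 @[x --> p] --> p.2.2 by apply: cvg_comp c2 _; exact: cvg_snd.
have cs : sigma x.1.2 x.2.1 @[x --> p] --> sigma p.1.2 p.2.1.
  by apply: continuous2_cvg c12 c21; exact: (@action_continuous _ _ sigma (_, _)).
have cT : (x.1.1 * sigma x.1.2 x.2.1) @[x --> p] --> p.1.1 * sigma p.1.2 p.2.1.
  by apply: continuous2_cvg c11 cs; exact: (@mulg_continuous T (_, _)).
have cG : (x.1.2 * x.2.2) @[x --> p] --> p.1.2 * p.2.2.
  by apply: continuous2_cvg c12 c22; exact: (@mulg_continuous G (_, _)).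
exact: cvg_pair cT cG.
Qed.

HB.instance Definition _ :=
  Semigroup_isTopSemigroup.Build P semidirect_mul_continuous.

End Semidirect.

(* [None] is the attached zero; it is isolated since it imposes no condition on
   open sets. *)
Definition attach_zero (T : Type) : Type := option T.

Section AttachZero.
Variable T : topSemigroupType.
Local Notation T0 := (attach_zero T).

HB.instance Definition _ := Choice.copy T0 (option T).

Definition zero_open : set (set T0) := [set U | open (Some @^-1` U)].

Lemma zero_openT : zero_open setT.
Proof. by rewrite /zero_open /= preimage_setT; exact: openT. Qed.

Lemma zero_openI : setI_closed zero_open.
Proof. by move=> U V oU oV; rewrite /zero_open /= preimage_setI; exact: openI. Qed.

Lemma zero_open_bigU (I : Type) (f : I -> set T0) :
  (forall i, zero_open (f i)) -> zero_open (\bigcup_i f i).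
Proof.
move=> of_; rewrite /zero_open /= preimage_bigcup.
by apply: bigcup_open => i _; exact: of_.
Qed.

HB.instance Definition _ :=
  isOpenTopological.Build T0 zero_openT zero_openI zero_open_bigU.

Definition zero_mul (x y : T0) : T0 :=
  match x, y with
  | Some s, Some t => Some (s * t)
  | _, _ => None
  end.

Lemma zero_mulA : associative zero_mul.
Proof. by move=> [x|] [y|] [z|] //=; rewrite mulgA. Qed.

HB.instance Definition _ := isSemigroup.Build T0 zero_mulA.

Lemma zero_mul_continuous :
  continuous (fun p : (T0 * T0)%type => p.1 * p.2).
Proof.
have nS (t : T) (U : set T) : nbhs t U -> nbhs (Some t : T0) (Some @` U).
  rewrite nbhsE => -[V [oV Vt] VU].
  have oSV : zero_open (Some @` V).
    rewrite /zero_open /= (_ : _ @^-1` _ = V) // eqEsubset.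
    by split=> [x [z Vz [<-]]|x Vx] //; exists x.
  exists (Some @` V); split; [exact: oSV|by exists t|exact: image_subset].
have oN : zero_open [set None].
  by rewrite /zero_open /= (_ : _ @^-1` _ = set0) ?eqEsubset; [exact: open0|split].
have nN : nbhs (None : T0) [set None] by exists [set None]; split.
have nA (x : T0) (U : set T0) : nbhs x U -> U x by exact: nbhs_singleton.
case=> -[s|] y A.
  case: y => [t|].
    case=> B [oB Bst BA].
    have : nbhs (s, t) [set p : (T * T)%type | B (Some (p.1 * p.2))].
      apply: (mulg_continuous (s, t)
        (Some @^-1` B)); exact: open_nbhs_nbhs.
    case=> -[V W] /= [Vs Wt] VWB; exists (Some @` V, Some @` W).
      by split; exact: nS.
    move=> [_ _] /= [[v Vv <-] [w Ww <-]]; apply: BA.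
    exact: (VWB (v, w)).
  move=> /nA /= AN; exists (setT, [set None]) => /=.
    by split=> //; exact: filterT.
  by move=> [[u|] _] /= [_ ->].
move=> /nA /= AN; exists ([set None], setT) => /=.
  by split=> //; exact: filterT.
by move=> [_ u] /= [-> _].
Qed.

HB.instance Definition _ :=
  Semigroup_isTopSemigroup.Build T0 zero_mul_continuous.

End AttachZero.

Definition class_H (S : topSemigroupType) : Prop :=
  exists G : topGroupType, embeds S (hyperspace G).

(* In [class_H0_zero] the compact semigroup ranges over all of [class_H], not
   only over members of [class_H0]. *)
Inductive class_H0 : topSemigroupType -> Prop :=
| class_H0_subdirect (I : Type) (S : I -> topSemigroupType)
    (T : topSemigroupType) :
    (forall i, class_H0 (S i)) -> embeds T (prod_topology S) -> class_H0 T
| class_H0_semidirect (G : topGroupType) (T : topSemigroupType)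
    (sigma : continuous_action G T) :
    (forall g h : G, commute g h) -> class_H0 T -> class_H0 (semidirect sigma)
| class_H0_zero (T : topSemigroupType) :
    compact [set: T] -> class_H T -> class_H0 (attach_zero T).

Section Properties.
Variable S : topSemigroupType.

Definition subsemigroup (A : set S) : Prop :=
  forall x y, A x -> A y -> A (x * y).

Definition subgroup (A : set S) : Prop :=
  subsemigroup A /\
  exists e, [/\ A e, (forall x, A x -> e * x = x /\ x * e = x) &
    forall x, A x -> exists y, [/\ A y, x * y = e & y * x = e]].

Definition clifford : Prop := forall x : S, exists2 A, subgroup A & A x.

Definition inverse_of (x y : S) : Prop := x * y * x = x /\ y * x * y = y.

Definition inverse_semigroup : Prop := forall x, exists! y, inverse_of x y.

Definition topological_inverse : Prop :=
  inverse_semigroup /\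
  exists2 inv : S -> S, (forall x, inverse_of x (inv x)) & continuous inv.

Definition idempotents : set S := [set e | e * e = e].

(* [E] carries the subspace topology, as the type [set_type E]. *)
Definition lawson (E : set S) : Prop :=
  basis [set U : set E | open U /\ subsemigroup (set_val @` U)].

End Properties.

Arguments clifford : clear implicits.
Arguments topological_inverse : clear implicits.
Arguments idempotents : clear implicits.

(* Main.v *)
(* Every compact Clifford semigroup in [class_H0] is Hausdorff and two further
   properties pass through the three constructions: idempotents whose product
   lies in a subgroup commute, and a point [x] not above [e] in a compact
   semilattice of idempotents is avoided by a closed subsemilattice which is a
   neighborhood of [e].  In a hyperspace the idempotents are compact subgroups.
   There the second property comes from Haar means: averaging over commuting
   compact subgroups [K] gives commuting orthogonal projections [P_K] on the
   continuous functions on the largest subgroup [M], which commute with each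
   convolution operator [T].  The bound [|(1 - P_K) T f| <= e |f|] holds for [K]
   near [H] (after composing [T] with [P_H]), and it is inherited by products of
   subgroups because [1 - P_KL = (1 - P_K) + P_K (1 - P_L)] is an orthogonal sum.
   The image of such a semilattice of idempotents is a continuous semilattice in
   the sense of domain theory, hence Lawson by interpolation of the way-below
   relation.

   Conversely, if [E] is the idempotent semilattice of [S], with maximal subgroups
   [H_c], the pairs [(I, s)] in which [I] is a set of idempotents that contains
   those way below [s s^-1] and is bounded by [s s^-1] form a compact Clifford
   semigroup over [S].  It embeds into the product of the groups with zero [H_c^0]
   by sending [(I, s)] to [c s] if [c] is in [I] and to zero otherwise. *)
Require Import Defs.
From HB Require Import structures.
From mathcomp Require Import all_boot all_order all_algebra ring lra.
From mathcomp Require Import all_classical all_reals all_analysis.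
From mathcomp Require Import Rstruct.

Set Implicit Arguments.
Unset Strict Implicit.
Unset Printing Implicit Defensive.

Import Order.TTheory GRing.Theory Num.Theory.
Import numFieldNormedType.Exports.

Local Open Scope classical_set_scope.
Local Open Scope ring_scope.

(** Factors of a subdirect product need be neither Clifford nor compact, so both properties are
    stated locally, for one subgroup or one compact semilattice; in this form they can be carried
    into a factor. In a hyperspace, nearness of [K] to [H] gives no bound on [1 - P_K] itself.
    Composing with [P_H] helps because [(1 - P_K) P_H = P_H - P_KH], and [K H] is near [H H = H].
    Convolution helps because Vietoris nearness controls means uniformly only over compact families
    of functions: a continuous kernel on pairs from [M] is such a family, the unit ball of functions
    is not. The bound is in quadratic mean because orthogonality lets arbitrarily many factors share
    one constant, where a triangle inequality would add up the errors. In the cover, [I] may vary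
    between the way-below set and the down-set of the unit because this interval condition is
    closed, while fixing [I] as the whole down-set is in general not; the way-below part recovers
    [s] as a limit of the products [c s]. *)

(** * Continuity and compactness tools *)

Lemma continuous_pair_comp (X Y Z W : topologicalType) (h : (Y * Z)%type -> W)
    (f : X -> Y) (g : X -> Z) :
  continuous h -> continuous f -> continuous g ->
  continuous (fun x => h (f x, g x)).
Proof.
move=> hc fc gc x.
have fgx : (f y, g y) @[y --> x] --> (f x, g x) by apply: cvg_pair; [exact: fc|exact: gc].
exact: (cvg_comp _ _ fgx (hc (f x, g x))).
Qed.

Lemma continuous_compose (X Y Z : topologicalType) (g : Y -> Z) (f : X -> Y) :
  continuous g -> continuous f -> continuous (fun x => g (f x)).
Proof. by move=> gc fc x; exact: (continuous_comp (fc x) (gc (f x))). Qed.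

Lemma continuous_fst_proj (X Y : topologicalType) : continuous (@fst X Y).
Proof. by move=> x; exact: cvg_fst. Qed.

Lemma continuous_snd_proj (X Y : topologicalType) : continuous (@snd X Y).
Proof. by move=> x; exact: cvg_snd. Qed.

Lemma continuous_mulg (X : topologicalType) (S : topSemigroupType)
    (f g : X -> S) :
  continuous f -> continuous g -> continuous (fun x => (f x * g x)%g).
Proof.
move=> fc gc; apply: (@continuous_pair_comp _ _ _ _ (fun p : S * S => (p.1 * p.2)%g)) => //.
exact: mulg_continuous.
Qed.

Lemma continuous_invg (X : topologicalType) (G : topGroupType) (f : X -> G) :
  continuous f -> continuous (fun x => (f x)^-1%g).
Proof. by move=> fc; apply: continuous_compose fc; exact: invg_continuous. Qed.

(** Near-covering compactness is applied to the filter of lists that contain a prescribed finite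
    list from [P], so the finite subcover comes out as a single list. *)
Lemma compact_finite_nbhs_cover (T : topologicalType) (I : choiceType) (K : set T)
    (P : set I) (N : I -> set T) :
  compact K -> (forall x, K x -> exists2 i, P i & nbhs x (N i)) ->
  exists2 s : seq I, {in s, forall i, P i} &
    forall x, K x -> exists2 i, i \in s & N i x.
Proof.
move=> /compact_near_coveringP cK KN.
pose F : set_system (seq I) := [set A | exists2 s0 : seq I, {in s0, forall i, P i} &
  forall s : seq I, {subset s0 <= s} -> A s].
have FF : Filter F.
  split; first by exists [::].
  - move=> A B [s Ps sA] [t Pt tB]; exists (s ++ t).
      by move=> i; rewrite mem_cat => /orP[/Ps|/Pt].
    by move=> u stu; split; [apply: sA|apply: tB] => i ui; apply: stu;
      rewrite mem_cat ui ?orbT.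
  - by move=> A B AB [s Ps sA]; exists s => // t /sA/AB.
have [x Kx|s Ps sN] := cK (seq I) F (fun s x => exists2 i, i \in s & N i x) FF.
  have [i Pi Ni] := KN x Kx.
  exists (N i, [set s : seq I | i \in s]) => /=.
    split=> //; exists [:: i]; first by move=> j; rewrite inE => /eqP->.
    by move=> s; apply; rewrite inE.
  by move=> [y s] /= [Niy si]; exists i.
by exists s => // x Kx; apply: sN.
Qed.

(** * Haar means on compact subgroups *)

Section Averages.
Variables (R : realType) (G : topGroupType).
Implicit Types (A B : seq G) (f g : G -> R).

Definition avg A f : R := (size A)%:R^-1 * \sum_(a <- A) f a.

Lemma avgD A f g : avg A (fun a => f a + g a) = avg A f + avg A g.
Proof. by rewrite /avg big_split /= mulrDr. Qed.

Lemma avgN A f : avg A (fun a => - f a) = - avg A f.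
Proof. by rewrite /avg sumrN mulrN. Qed.

Lemma avgB A f g : avg A (fun a => f a - g a) = avg A f - avg A g.
Proof. by rewrite avgD avgN. Qed.

Lemma avgZ A f c : avg A (fun a => c * f a) = c * avg A f.
Proof. by rewrite /avg -mulr_sumr mulrCA. Qed.

Lemma size_neq0 A : A != [::] -> (size A)%:R != 0 :> R.
Proof. by case: A => // a A _; rewrite pnatr_eq0. Qed.

Lemma avg_cst A c : A != [::] -> avg A (fun=> c) = c.
Proof.
move=> /size_neq0 A0; rewrite /avg big_const_seq count_predT iter_addr_0.
by rewrite -[c *+ _]mulr_natl mulKf.
Qed.

Lemma avg_le A f g : {in A, forall a, f a <= g a} -> avg A f <= avg A g.
Proof.
move=> fg; rewrite /avg ler_wpM2l ?invr_ge0 ?ler0n//.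
by rewrite big_seq [leRHS]big_seq; exact: ler_sum.
Qed.

Lemma eq_avg A f g : {in A, f =1 g} -> avg A f = avg A g.
Proof.
move=> fg; rewrite /avg; congr *%R.
by rewrite big_seq [RHS]big_seq; exact: eq_bigr.
Qed.

Lemma avg_dist A f c d : A != [::] ->
  {in A, forall a, `|f a - c| <= d} -> `|avg A f - c| <= d.
Proof.
move=> A0 fc; rewrite -[X in _ - X](avg_cst c A0) -avgB ler_norml.
rewrite -[- d](avg_cst (- d) A0) -[X in _ && (_ <= X)](avg_cst d A0).
by apply/andP; split; apply: avg_le => a /fc; rewrite ler_norml => /andP[].
Qed.

Lemma avg_dist2 A f g d : A != [::] ->
  {in A, forall a, `|f a - g a| <= d} -> `|avg A f - avg A g| <= d.
Proof.
move=> A0 fg; rewrite -avgB -[X in `|X|]subr0; apply: avg_dist => // a /fg.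
by rewrite subr0.
Qed.

Lemma avg_exchange A B (F : G -> G -> R) :
  avg A (fun a => avg B (F a)) = avg B (fun b => avg A (F^~ b)).
Proof.
by rewrite /avg -!mulr_sumr mulrCA exchange_big.
Qed.

(** One value that falls short by [e] lowers the whole average by [e / size A]; the contraction
    factor below comes from here. *)
Lemma avg_le_drop A f a0 D e : a0 \in A -> 0 <= e ->
  {in A, forall a, f a <= D} -> f a0 <= D - e ->
  avg A f <= D - e / (size A)%:R.
Proof.
move=> Aa0 e0 fD fa0.
have A0 : A != [::] by case: (A) Aa0.
have n0 := size_neq0 A0.
rewrite /avg mulrC ler_pdivrMr; last by rewrite lt0r n0 ler0n.
rewrite mulrBl divfK// (big_rem a0)//= mulrC.
have : \sum_(a <- rem a0 A) f a <= (size A).-1%:R * D.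
  rewrite -(size_rem Aa0) mulr_natl -iter_addr_0 -count_predT -big_const_seq.
  by rewrite big_seq [leRHS]big_seq; apply: ler_sum => a /mem_rem/fD.
have : (size A)%:R = (size A).-1%:R + 1 :> R.
  by case: (A) A0 => // a s _; rewrite /= -natr1.
move=> ->; lra.
Qed.

Definition prod_seq A B : seq G := [seq (a * b)%g | a <- A, b <- B].

Lemma avg_prod_seq A B f :
  avg (prod_seq A B) f = avg A (fun a => avg B (fun b => f (a * b)%g)).
Proof.
rewrite /avg size_allpairs natrM invfM big_allpairs_dep /= -mulr_sumr -mulrA.
by congr *%R; rewrite mulrC mulrC.
Qed.

End Averages.

Section Subgroups.
Variable G : topGroupType.
Implicit Types (K : set G).

Definition compact_subgroup K : Prop :=
  [/\ compact K, K 1%g, forall x y, K x -> K y -> K (x * y)%g &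
      forall x, K x -> K x^-1%g].

Definition averaging_seq K (A : seq G) : Prop :=
  A != [::] /\ {in A, forall a, K a}.

Lemma averaging_seq_prod K A B : compact_subgroup K ->
  averaging_seq K A -> averaging_seq K B -> averaging_seq K (prod_seq A B).
Proof.
move=> [_ _ KM _] [A0 KA] [B0 KB]; split; first by case: A B A0 B0 {KA KB} => [|a A] [|b B].
by move=> x /allpairsP[[a b] /= [Aa Bb ->]]; apply: KM; [exact: KA|exact: KB].
Qed.

(** The list depends on [K] and [V] only, not on a function; this is what later lets one averaging
    sequence serve a whole family of functions. *)
Lemma averaging_seq_meets K V : compact_subgroup K -> nbhs (1%g : G) V ->
  exists2 A, averaging_seq K A & forall x, K x -> exists2 a, a \in A & V (x * a)%g.
Proof.
move=> [cK K1 KM KV] V1.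
have [x Kx|D DK KD] := compact_finite_nbhs_cover (P := K)
    (N := fun y => [set x | V (x * y^-1)%g]) cK.
  exists x => //; have : continuous (fun z => z * x^-1)%g.
    by apply: continuous_mulg => z; [exact: cvg_id|exact: cvg_cst].
  by apply; rewrite mulgV.
have meets x : K x -> exists2 a, a \in [seq y^-1%g | y <- D] & V (x * a)%g.
  move=> /KD[y /= yD Vxy]; exists y^-1%g => //.
  by apply/mapP; exists y.
exists [seq y^-1%g | y <- D] => //; split.
  by have [a] := meets 1%g K1; case: (map _ _).
by move=> _ /mapP[y yD ->]; exact/KV/DK.
Qed.

End Subgroups.

Section Mean.
Variables (R : realType) (G : topGroupType).
Implicit Types (A B : seq G) (f g : G -> R) (K : set G).

(* Some pair of translates brings both points close to [1], where [f] is nearly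
   constant; the other pairs are bounded by the oscillation of [f]. *)
Lemma averages_contract K V (d : R) : compact_subgroup K -> nbhs (1%g : G) V ->
  0 <= d -> exists q : R, [/\ 0 <= q, q < 1 & forall k : nat,
  exists2 A, averaging_seq K A & forall f (c : R),
   (forall x v, K x -> K v -> V v -> `|f (v * x)%g - f x| <= d) ->
   0 <= c -> (forall x y, K x -> K y -> f x - f y <= 2 * d + c) ->
   forall x y, K x -> K y ->
   avg A (fun a => f (x * a)%g) - avg A (fun a => f (y * a)%g) <= 2 * d + q ^+ k * c].
Proof.
move=> gK V1 d0; have [cK K1 KM KV] := gK.
have [A0 [A00 KA0] meetsV] := averaging_seq_meets gK V1.
pose n : R := (size A0)%:R.
have n1 : 1 <= n by rewrite /n ler1n; case: (A0) A00.
have n0 : 0 < n by exact: lt_le_trans n1.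
(* The average of [f (x * a) - f (y * b)] runs over [n ^ 2] pairs, and one of them is at most
   [2 * d] instead of [2 * d + c]; hence the gain [c / n / n]. *)
exists (1 - n^-1 * n^-1); split.
- by rewrite subr_ge0 mulr_ile1 ?invr_ge0 ?invf_le1 ?(ltW n0).
- by rewrite ltrBlDr ltrDl mulr_gt0 ?invr_gt0.
set q := 1 - _.
have q0 : 0 <= q by rewrite subr_ge0 mulr_ile1 ?invr_ge0 ?invf_le1 ?(ltW n0).
elim=> [|{}k [A [Ane KA] IH]].
  exists [:: 1%g]; first by split=> // a; rewrite inE => /eqP->.
  move=> f c _ c0 osc x y Kx Ky.
  rewrite /avg !big_seq1 !mulg1 invr1 !mul1r; exact: osc.
exists (prod_seq A A0); first exact: averaging_seq_prod.
move=> f c fV c0 osc x y Kx Ky; rewrite !avg_prod_seq.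
pose f1 z := avg A0 (fun b => f (z * b)%g).
have E1 z : avg A (fun a => avg A0 (fun b => f (z * (a * b))%g)) = avg A (fun a => f1 (z * a)%g).
  by apply: eq_avg => a _; apply: eq_avg => b _; rewrite mulgA.
rewrite !E1 exprSr -mulrA.
apply: IH => //; last 2 first.
- exact: mulr_ge0.
- move=> {Kx Ky x y} x y Kx Ky.
  have [a0 Aa0 Va0] := meetsV x Kx; have [b0 Ab0 Vb0] := meetsV y Ky.
  have Kxa a : a \in A0 -> K (x * a)%g by move=> /KA0; exact: KM.
  have Kyb b : b \in A0 -> K (y * b)%g by move=> /KA0; exact: KM.
  have H1 : `|f (x * a0)%g - f 1%g| <= d.
    by rewrite -[X in f X]mulg1; apply: fV => //; exact: Kxa.
  have H2 : `|f (y * b0)%g - f 1%g| <= d.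
    by rewrite -[X in f X]mulg1; apply: fV => //; exact: Kyb.
  have E u : u - f1 y = avg A0 (fun b => u - f (y * b)%g) by rewrite avgB avg_cst.
  have -> : f1 x - f1 y = avg A0 (fun a => f (x * a)%g - f1 y).
    by rewrite avgB avg_cst.
  rewrite (_ : _ + _ = 2 * d + c - (c / n) / n); last by rewrite /q; ring.
  apply: (@avg_le_drop _ _ _ _ a0) => //; first by rewrite divr_ge0// ltW.
    move=> a Aa; rewrite E -[leRHS](avg_cst _ A00); apply: avg_le => b Ab.
    by apply: osc; [exact: Kxa|exact: Kyb].
  rewrite E; apply: (@avg_le_drop _ _ _ _ b0) => //.
    by move=> b Ab; apply: osc; [exact: Kxa|exact: Kyb].
  move: H1 H2; rewrite !ler_norml => /andP[? ?] /andP[? ?]; lra.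
(* Right averaging keeps the modulus of continuity, since [v] acts on the left. *)
- move=> z v Kz Kv Vv; apply: avg_dist2 => // b Ab; rewrite -mulgA; apply: fV => //.
  by apply: KM => //; exact: KA0.
Qed.

Lemma averages_uniform K V (d c : R) : compact_subgroup K -> nbhs (1%g : G) V ->
  0 < d -> 0 <= c -> exists2 A, averaging_seq K A & forall f,
   (forall x v, K x -> K v -> V v -> `|f (v * x)%g - f x| <= d) ->
   (forall x y, K x -> K y -> f x - f y <= c) ->
   forall x y, K x -> K y ->
   `|avg A (fun a => f (x * a)%g) - avg A (fun a => f (y * a)%g)| <= 3 * d.
Proof.
move=> gK V1 d0 c0; have [q [q0 q1 contr]] := averages_contract gK V1 (ltW d0).
have [k qk] : exists k, q ^+ k * c <= d.
  have : q ^+ k * c @[k --> \oo] --> 0 * c.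
    by apply: cvgMr_tmp; apply: cvg_expr; rewrite ger0_norm.
  rewrite mul0r => /cvgrPdist_le /(_ d d0)[k _ /(_ k)] /= H; exists k.
  by apply: le_trans (H _); rewrite // sub0r normrN ler_norm.
have [A KA HA] := contr k; exists A => // f fV osc x y Kx Ky.
have le3 z t : K z -> K t -> avg A (fun a => f (z * a)%g) - avg A (fun a => f (t * a)%g) <= 3 * d.
  move=> Kz Kt; apply: le_trans (HA f c fV c0 _ z t Kz Kt) _; last by lra.
  by move=> u v Ku Kv; have := osc u v Ku Kv; lra.
by rewrite ler_norml le3// andbT lerNl opprB le3.
Qed.

Section Parametric.
Variables (X : topologicalType) (F : X -> G -> R) (C : set X) (K : set G).
Hypotheses (Fc : continuous (fun p : X * G => F p.1 p.2)) (cC : compact C)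
  (cK : compact K).

(** Tube lemma around [1] times the compact set of pairs from [C] and [K]: the difference vanishes
    at [v = 1], so one [V] works for all parameters. *)
Lemma equicontinuous_family d : 0 < d -> K !=set0 ->
  exists2 V, nbhs (1%g : G) V &
    forall c x v, C c -> K x -> V v -> `|F c (v * x)%g - F c x| <= d.
Proof.
move=> d0 [x0 Kx0].
have [->|/set0P[c0 Cc0]] := eqVneq C set0.
  by exists setT => //; exact: filterT.
have [|||_ [c x] -> [/= Cc Kx]|V [W [Vn Wn VW]]] := @compact_prod_nbhs G (X * G)%type [set 1%g] (C `*` K)
    [set p | `|F p.2.1 (p.1 * p.2.2)%g - F p.2.1 p.2.2| <= d].
- exact: compact_set1.
- exact: compact_setX.
- by exists (c0, x0).
- have c1 : continuous (fun p : G * (X * G) => F p.2.1 (p.1 * p.2.2)%g - F p.2.1 p.2.2).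
    have c21 : continuous (fun p : G * (X * G) => p.2.1).
      by apply: (continuous_compose (@continuous_fst_proj _ _)); exact: continuous_snd_proj.
    have c22 : continuous (fun p : G * (X * G) => p.2.2).
      by apply: (continuous_compose (@continuous_snd_proj _ _)); exact: continuous_snd_proj.
    move=> p; apply: cvgB.
      apply: (@continuous_pair_comp _ _ _ _ _ (fun p => p.2.1) (fun p => p.1 * p.2.2)%g Fc c21).
      by apply: continuous_mulg => //; exact: continuous_fst_proj.
    exact: (@continuous_pair_comp _ _ _ _ _ (fun p => p.2.1) (fun p => p.2.2) Fc c21 c22).
  have := c1 (1%g, (c, x)); rewrite /continuous_at /= mul1g subrr.
  move=> /cvgrPdist_le /(_ d d0); apply: filterS => p /=.
  by rewrite sub0r normrN.
- exists V; first exact: Vn.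
  move=> c x v Cc Kx Vv; apply: (VW (v, (c, x))); split => //=.
  by apply: nbhs_singleton; exact: Wn.
Qed.

Lemma bounded_family : exists2 b, 0 <= b & forall c x, C c -> K x -> `|F c x| <= b.
Proof.
have : compact ((fun p : X * G => F p.1 p.2) @` (C `*` K)).
  by apply: continuous_compact; [exact: continuous_subspaceT|exact: compact_setX].
move=> /compact_bounded[M [_ /(_ (`|M| + 1))]] /(_ _) H.
exists (`|M| + 1) => [|c x Cc Kx]; first by rewrite addr_ge0.
apply: H; last by exists (c, x).
by rewrite (le_lt_trans (ler_norm M))// ltrDl.
Qed.
End Parametric.
End Mean.

Lemma nbhs_gtr (R : realType) (X : topologicalType) (f : X -> R) x (c : R) :
  continuous f -> c < f x -> nbhs x [set y | c < f y].
Proof. by move=> fc cf; exact: (@cvgr_gt R X (nbhs x) _ f (f x) (fc x) c cf). Qed.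

Lemma nbhs_distr (R : realType) (X : topologicalType) (f : X -> R) x (e : R) :
  continuous f -> 0 < e -> nbhs x [set y | `|f x - f y| <= e].
Proof. by move=> fc e0; have /cvgrPdist_le/(_ e e0) := fc x. Qed.

Lemma continuous_addr (R : realType) (X : topologicalType) (f g : X -> R) :
  continuous f -> continuous g -> continuous (fun x => f x + g x).
Proof. by move=> fc gc x; apply: cvgD; [exact: fc|exact: gc]. Qed.

Lemma continuous_subr (R : realType) (X : topologicalType) (f g : X -> R) :
  continuous f -> continuous g -> continuous (fun x => f x - g x).
Proof. by move=> fc gc x; apply: cvgB; [exact: fc|exact: gc]. Qed.

Lemma continuous_mulr (R : realType) (X : topologicalType) (f g : X -> R) :
  continuous f -> continuous g -> continuous (fun x => f x * g x).
Proof. by move=> fc gc x; apply: cvgM; [exact: fc|exact: gc]. Qed.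

Lemma continuous_avg (R : realType) (G : topGroupType) (X : topologicalType)
    (A : seq G) (F : X -> G -> R) :
  (forall a, continuous (F^~ a)) -> continuous (fun x => avg A (F x)).
Proof.
move=> Fc; apply: continuous_mulr; first by move=> x; exact: cvg_cst.
elim: A => [|a A IH].
  by under eq_fun do rewrite big_nil; move=> x; exact: cvg_cst.
under eq_fun do rewrite big_cons; exact: continuous_addr.
Qed.

Lemma continuous_lmulg (S : topSemigroupType) (k : S) : continuous (monoid.mul k).
Proof.
have ck : continuous (fun _ : S => k) by move=> x; exact: cvg_cst.
have ci : continuous (@id S) by move=> x; exact: cvg_id.
exact: (continuous_mulg ck ci).
Qed.

Ltac cont := repeat match goal with |- forall x, @continuous_at _ _ x ?h =>
  first [ assumption | lazymatch h with
  | (fun x => (@?f x - @?g x)%R) => apply: continuous_subr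
  | (fun x => (@?f x + @?g x)%R) => apply: continuous_addr
  | (fun x => (@?f x * @?g x)%R) => apply: continuous_mulr
  | (fun x => (@?f x * @?g x)%g) => apply: continuous_mulg
  | (fun x => (@?f x)^-1%g) => apply: continuous_invg
  | (fun x => fst x) => exact: continuous_fst_proj
  | (fun x => snd x) => exact: continuous_snd_proj
  | (fun x => fst (@?f x)) => apply: (continuous_compose (@continuous_fst_proj _ _))
  | (fun x => snd (@?f x)) => apply: (continuous_compose (@continuous_snd_proj _ _))
  | (fun x => x) => by move=> ?; exact: cvg_id
  | id => by move=> ?; exact: cvg_id
  | monoid.inv => exact: invg_continuous
  | monoid.mul ?k => exact: continuous_lmulg
  | fst => exact: continuous_fst_proj
  | snd => exact: continuous_snd_proj
  | _ => exact: cst_continuous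
  end ] end.

Section MeanDef.
Variables (R : realType) (G : topGroupType).
Implicit Types (A B : seq G) (f g : G -> R).

(* The constant approximated by right averages; it is also the one approximated
   by left averages, which makes it the Haar integral. *)
Definition mean (K : set G) f : R :=
  sup [set c | exists2 A, averaging_seq K A &
    forall x, K x -> c <= avg A (fun a => f (x * a)%g)].

Variables (K : set G) (gK : compact_subgroup K).

(** Both constants are compared with the double average of [f (b * a)], read in either order. *)
Lemma left_right_averages A B f c c' d d' :
  averaging_seq K A -> averaging_seq K B ->
  (forall x, K x -> `|avg A (fun a => f (x * a)%g) - c| <= d) ->
  (forall x, K x -> `|avg B (fun b => f (b * x)%g) - c'| <= d') ->
  `|c - c'| <= d + d'.
Proof.
move=> [A0 KA] [B0 KB] Ac Bc'.
rewrite (le_trans (ler_distD (avg B (fun b => avg A (fun a => f (b * a)%g))) _ _))//.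
rewrite lerD//; first by rewrite distrC; apply: avg_dist => // b /KB/Ac.
by rewrite avg_exchange; apply: avg_dist => // a /KA/Bc'.
Qed.

Lemma right_averages f d : continuous f -> 0 < d -> exists2 A, averaging_seq K A &
  exists c, forall x, K x -> `|avg A (fun a => f (x * a)%g) - c| <= d.
Proof.
move=> fc d0; have [cK K1 _ _] := gK.
have Fc : continuous (fun p : G * G => f p.2) by apply: (continuous_compose fc); cont.
have [|||V V1 fV] := @equicontinuous_family R G G (fun=> f) [set 1%g] K Fc _ cK (d / 3).
- exact: compact_set1.
- by rewrite divr_gt0.
- by exists 1%g.
have [|b b0 fb] := @bounded_family R G G (fun=> f) [set 1%g] K Fc _ cK.
  exact: compact_set1.
have [A KA AP] := @averages_uniform R G K V (d / 3) (2 * b) gK V1 (divr_gt0 d0 (ltr0n _ 3)) (mulr_ge0 (ler0n _ 2) b0).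
exists A => //; exists (avg A (fun a => f (1%g * a)%g)) => x Kx.
rewrite (_ : d = 3 * (d / 3)); last by field.
apply: AP => // [y v Ky _ Vv|y z Ky Kz]; first exact: (fV 1%g).
have := fb 1%g y erefl Ky; have := fb 1%g z erefl Kz.
rewrite !ler_norml => /andP[? ?] /andP[? ?]; lra.
Qed.

Lemma left_averages f d : continuous f -> 0 < d -> exists2 B, averaging_seq K B &
  exists c, forall x, K x -> `|avg B (fun b => f (b * x)%g) - c| <= d.
Proof.
move=> fc d0; have [cK K1 _ KV] := gK.
have [|A [A0 KA] [c Ac]] := @right_averages (fun x => f x^-1%g) d _ d0.
  by apply: (continuous_compose fc); cont.
exists [seq a^-1%g | a <- A].
  split; first by case: (A) A0.
  by move=> _ /mapP[a /KA Ka ->]; exact: KV.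
exists c => x Kx; have := Ac x^-1%g (KV _ Kx).
congr (`|_ - c| <= d); rewrite /avg size_map big_map; congr *%R.
by apply: eq_bigr => a _; rewrite invgM invgK.
Qed.

(** Here [c - d] is a member of the set whose supremum is [mean K f], and comparison with a left
    average bounds every member by [c + d]. *)
Lemma mean_approx A f c d : continuous f -> averaging_seq K A ->
  (forall x, K x -> `|avg A (fun a => f (x * a)%g) - c| <= d) ->
  `|c - mean K f| <= d.
Proof.
move=> fc KA Ac; pose L : set R := [set c | exists2 A, averaging_seq K A &
    forall x, K x -> c <= avg A (fun a => f (x * a)%g)].
have ubL : ubound L (c + d).
  move=> l [A' [A'0 KA'] lA']; apply/ler_addgt0Pr => e e0.
  have [B KB [c' Bc']] := left_averages fc (divr_gt0 e0 (ltr0n _ 2)).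
  have := left_right_averages KA KB Ac Bc'.
  have : l <= c' + e / 2.
    have [B0 KBb] := KB.
    apply: (@le_trans _ _ (avg B (fun b => avg A' (fun a => f (b * a)%g)))).
      by rewrite -[l](avg_cst _ B0); apply: avg_le => b /KBb/lA'.
    rewrite avg_exchange -[leRHS](avg_cst _ A'0); apply: avg_le => a /KA'/Bc'.
    by rewrite ler_norml => /andP[_]; lra.
  by rewrite ler_norml => ? /andP[? ?]; lra.
have Lcd : L (c - d).
  by exists A => // x /Ac; rewrite ler_norml => /andP[? _]; lra.
have supL : has_sup L by split; [exists (c - d)|exists (c + d)].
rewrite /mean -/L distrC ler_norml; apply/andP; split.
  by rewrite lerBrDl; have := sup_upper_bound supL Lcd; lra.
by rewrite lerBlDl; apply: sup_le_ub => //; exists (c - d).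
Qed.

(** One averaging sequence for a compact family of functions: linearity, exchange of means and
    continuity on the hyperspace all rest on this uniformity. *)
Lemma mean_uniform (X : topologicalType) (F : X -> G -> R) (C : set X) d :
  continuous (fun p : X * G => F p.1 p.2) -> compact C -> 0 < d ->
  exists2 A, averaging_seq K A & forall c x, C c -> K x ->
    `|avg A (fun a => F c (x * a)%g) - mean K (F c)| <= d.
Proof.
move=> Fc cC d0; have [cK K1 _ _] := gK.
have [||V V1 fV] := equicontinuous_family Fc cC cK (d := d / 3).
- by rewrite divr_gt0.
- by exists 1%g.
have [b b0 fb] := bounded_family Fc cC cK.
have [A KA AP] := @averages_uniform R G K V (d / 3) (2 * b) gK V1 (divr_gt0 d0 (ltr0n _ 3)) (mulr_ge0 (ler0n _ 2) b0).
exists A => // c x Cc Kx.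
have {}AP y : K y -> `|avg A (fun a => F c (y * a)%g) - avg A (fun a => F c (x * a)%g)| <= d.
  move=> Ky; rewrite (_ : d = 3 * (d / 3)); last by field.
  apply: AP => // [z v Kz _ Vv|z t Kz Kt]; first exact: fV.
  have := fb c z Cc Kz; have := fb c t Cc Kt.
  rewrite !ler_norml => /andP[? ?] /andP[? ?]; lra.
apply: (@mean_approx A) => //.
by apply: (continuous_pair_comp (f := fun=> c) (g := id) Fc); cont.
Qed.

Lemma mean_average f d : continuous f -> 0 < d -> exists2 A, averaging_seq K A &
  forall x, K x -> `|avg A (fun a => f (x * a)%g) - mean K f| <= d.
Proof.
move=> fc d0.
have [|||A KA AP] := @mean_uniform G (fun=> f) [set 1%g] d.
- by apply: (continuous_compose fc); cont.
- exact: compact_set1.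
- by [].
- by exists A => // x Kx; exact: (AP 1%g).
Qed.

Lemma mean_dist f g d : continuous f -> continuous g ->
  (forall x, K x -> `|f x - g x| <= d) -> `|mean K f - mean K g| <= d.
Proof.
move=> fc gc fg; apply/ler_addgt0Pr => e e0.
have [A [A0 KA] Af] := mean_average fc e0.
apply: (@mean_approx A) => // x Kx.
rewrite (le_trans (ler_distD (avg A (fun a => f (x * a)%g)) _ _))//.
rewrite lerD ?Af//; apply: avg_dist2 => // a Aa; rewrite distrC; apply: fg.
by have [_ _ KM _] := gK; apply: KM => //; exact: KA.
Qed.

Lemma eq_mean f g : continuous f -> continuous g ->
  (forall x, K x -> f x = g x) -> mean K f = mean K g.
Proof.
move=> fc gc fg; apply/eqP; rewrite -subr_eq0 -normr_le0; apply: mean_dist => // x Kx.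
by rewrite fg// subrr normr0.
Qed.

Lemma mean_cst c : mean K (fun=> c) = c.
Proof.
have [_ K1 _ _] := gK.
apply/eqP; rewrite -subr_eq0 -normr_le0 distrC; apply: (@mean_approx [:: 1%g]).
- exact: cst_continuous.
- by split=> // a; rewrite inE => /eqP->.
- by move=> x Kx; rewrite avg_cst// subrr normr0.
Qed.

Lemma mean_linear f g t : continuous f -> continuous g ->
  mean K (fun x => f x + t * g x) = mean K f + t * mean K g.
Proof.
move=> fc gc; apply/eqP; rewrite -subr_eq0 -normr_le0; apply/ler_addgt0Pr => e e0.
rewrite add0r; pose d := e / (2 + `|t|).
have t0 : 0 < 2 + `|t| by rewrite ltr_pwDl.
(* The parameters [(1, 0)], [(0, 1)] and [(1, t)] stand for [f], [g] and [f + t g], which thus get a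
   common averaging sequence. *)
have [|||A KA AP] := @mean_uniform (R * R)%type (fun p x => p.1 * f x + p.2 * g x)
    ([set (1, 0)] `|` [set (0, 1)] `|` [set (1, t)]) d.
- apply: continuous_addr; apply: continuous_mulr; cont.
    by apply: (continuous_compose fc); cont.
  by apply: (continuous_compose gc); cont.
- by apply: compactU; [apply: compactU|]; exact: compact_set1.
- by rewrite divr_gt0.
have [_ K1 _ _] := gK.
have := AP (1, 0) 1%g (or_introl (or_introl erefl)) K1.
have := AP (0, 1) 1%g (or_introl (or_intror erefl)) K1.
have := AP (1, t) 1%g (or_intror erefl) K1 => /=.
rewrite !avgD !avgZ !mul1r !mul0r add0r addr0.
set u := avg A _; set v := avg A _.
have -> : mean K (fun x => 1 * f x + 0 * g x) = mean K f.
  by congr mean; apply/funext => x; rewrite mul1r mul0r addr0.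
have -> : mean K (fun x => 0 * f x + 1 * g x) = mean K g.
  by congr mean; apply/funext => x; rewrite mul1r mul0r add0r.
have -> : mean K (fun x => 1 * f x + t * g x) = mean K (fun x => f x + t * g x).
  by congr mean; apply/funext => x; rewrite mul1r.
move=> H1 H2 H3.
rewrite (_ : _ - _ = (u - mean K f) + t * (v - mean K g) - (u + t * v - mean K (fun x => f x + t * g x))); last by ring.
rewrite (le_trans (ler_normB _ _))// (_ : e = d + `|t| * d + d); last first.
  by rewrite /d; field; rewrite gt_eqF.
rewrite lerD// (le_trans (ler_normD _ _))// lerD// normrM.
by rewrite ler_wpM2l.
Qed.

Lemma meanD f g : continuous f -> continuous g ->
  mean K (fun x => f x + g x) = mean K f + mean K g.
Proof.
move=> fc gc; rewrite -[X in _ + X]mul1r -mean_linear//.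
by congr mean; apply/funext => x; rewrite mul1r.
Qed.

Lemma meanB f g : continuous f -> continuous g ->
  mean K (fun x => f x - g x) = mean K f - mean K g.
Proof.
move=> fc gc; rewrite -[X in _ - X]mul1r -mulNr -mean_linear//.
by congr mean; apply/funext => x; rewrite mulN1r.
Qed.

Lemma meanZ f t : continuous f -> mean K (fun x => t * f x) = t * mean K f.
Proof.
move=> fc; rewrite -[RHS]add0r -(mean_cst 0) -mean_linear//; last exact: cst_continuous.
by congr mean; apply/funext => x; rewrite add0r.
Qed.

Lemma mean_ge0 f : continuous f -> (forall x, K x -> 0 <= f x) -> 0 <= mean K f.
Proof.
move=> fc f0; apply/ler_addgt0Pr => e e0.
have [A [A0 KA] Af] := mean_average fc e0.
have [_ K1 KM _] := gK; have := Af _ K1.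
have : 0 <= avg A (fun a => f (1 * a)%g).
  rewrite -[leLHS](avg_cst 0 A0); apply: avg_le => a Aa; apply: f0.
  by apply: KM => //; exact: KA.
rewrite ler_norml => ? /andP[? ?]; lra.
Qed.

Lemma mean_le f g : continuous f -> continuous g ->
  (forall x, K x -> f x <= g x) -> mean K f <= mean K g.
Proof.
move=> fc gc fg; rewrite -subr_ge0 -meanB//; apply: mean_ge0 => [|x Kx].
  exact: continuous_subr.
by rewrite subr_ge0 fg.
Qed.

Lemma mean_avg (H : G -> G -> R) A : A != [::] -> (forall a, continuous (H^~ a)) ->
  mean K (fun x => avg A (H x)) = avg A (fun a => mean K (H^~ a)).
Proof.
move=> A0 Hc; rewrite /avg meanZ; last first.
  elim: (A) => [|a {A0}A IH].
    by under eq_fun do rewrite big_nil; exact: cst_continuous.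
  by under eq_fun do rewrite big_cons; exact: continuous_addr.
congr *%R; elim: (A) => [|a {A0}A IH].
  by under eq_fun do rewrite big_nil; rewrite mean_cst big_nil.
under eq_fun do rewrite big_cons; rewrite meanD ?IH ?big_cons//.
elim: (A) => [|b {IH}B IH].
  by under eq_fun do rewrite big_nil; exact: cst_continuous.
by under eq_fun do rewrite big_cons; exact: continuous_addr.
Qed.

Lemma mean_mulr f k : continuous f -> K k -> mean K (fun x => f (x * k)%g) = mean K f.
Proof.
move=> fc Kk; have [_ K1 KM KV] := gK.
apply/eqP; rewrite eq_sym -subr_eq0 -normr_le0; apply/ler_addgt0Pr => e e0; rewrite add0r.
have [A [A0 KA] Af] := mean_average fc e0.
apply: (@mean_approx [seq a * k^-1 | a <- A]%g).
- by apply: (continuous_compose fc); cont.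
- split; first by case: (A) A0.
  by move=> _ /mapP[a /KA Ka ->]; apply: KM => //; exact: KV.
- move=> x Kx; have := Af x Kx; congr (`|_ - _| <= e).
  rewrite /avg size_map big_map; congr *%R.
  by apply: eq_bigr => a _; rewrite mulgA mulgVK.
Qed.

Lemma mean_mull f k : continuous f -> K k -> mean K (fun x => f (k * x)%g) = mean K f.
Proof.
move=> fc Kk; have [_ K1 KM KV] := gK.
apply/eqP; rewrite eq_sym -subr_eq0 -normr_le0; apply/ler_addgt0Pr => e e0; rewrite add0r.
have [A [A0 KA] Af] := mean_average fc e0.
apply: (@mean_approx A) => //.
  by apply: (continuous_compose fc); cont.
move=> x Kx; have := Af (k * x)%g (KM _ _ Kk Kx); congr (`|_ - _| <= e).
by apply: eq_avg => a _; rewrite mulgA.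
Qed.

Lemma mean_inv f : continuous f -> mean K (fun x => f x^-1%g) = mean K f.
Proof.
move=> fc; have [_ K1 KM KV] := gK.
have fVc : continuous (fun x => f x^-1%g) by apply: (continuous_compose fc); cont.
apply/eqP; rewrite eq_sym -subr_eq0 -normr_le0; apply/ler_addgt0Pr => e e0; rewrite add0r.
have e20 : 0 < e / 2 by rewrite divr_gt0.
have [A [A0 KA] Af] := mean_average fc e20.
have [B [B0 KB] Bf] := mean_average fVc e20.
rewrite (splitr e); apply: (@left_right_averages A [seq b^-1 | b <- B]%g f) => //.
- split; first by case: (B) B0.
  by move=> _ /mapP[b /KB Kb ->]; exact: KV.
- move=> x Kx; have := Bf x^-1%g (KV _ Kx); congr (`|_ - _| <= _).
  rewrite /avg size_map big_map; congr *%R.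
  by apply: eq_bigr => b _; rewrite invgM invgK.
Qed.

(** Finitely many translates of the set where [f] exceeds [f x0 / 2] cover [K], so an average of
    translates of [f], which has the same mean, is bounded below by a positive constant. *)
Lemma mean_gt0 f x0 : continuous f -> (forall x, K x -> 0 <= f x) ->
  K x0 -> 0 < f x0 -> 0 < mean K f.
Proof.
move=> fc f0 Kx0 fx0; have [cK K1 KM KV] := gK.
have ftc y : continuous (fun x => f (x * y)%g) by apply: (continuous_compose fc); cont.
have [x Kx|D DK KD] := @compact_finite_nbhs_cover G G K K
    (fun y => [set x | f x0 / 2 < f (x * (y^-1 * x0))%g]) cK.
  exists x => //; apply: (nbhs_gtr (ftc (x^-1 * x0)%g)).
  by rewrite mulgA mulgV mul1g; lra.
pose A := [seq y^-1 * x0 | y <- D]%g.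
have A0 : A != [::] by have [y] := KD _ K1; rewrite /A; case: (D).
have KA a : a \in A -> K a by move=> /mapP[y /DK Ky ->]; apply: KM => //; exact: KV.
have <- : mean K (fun x => avg A (fun a => f (x * a)%g)) = mean K f.
  rewrite mean_avg// -[RHS](avg_cst _ A0); apply: eq_avg => a /KA Ka.
  exact: mean_mulr.
have n0 : 0 < (size A)%:R :> R by rewrite lt0r size_neq0// ler0n.
apply: (@lt_le_trans _ _ (f x0 / 2 / (size A)%:R)); first by rewrite !divr_gt0.
rewrite -[leLHS]mean_cst; apply: mean_le.
- exact: cst_continuous.
- exact: continuous_avg.
move=> x Kx; have [y yD fy] := KD x Kx.
rewrite /avg mulrC ler_wpM2l ?invr_ge0 ?ler0n// /A big_map (big_rem y)//=.
apply: le_trans (ltW fy) _; rewrite lerDl big_seq sumr_ge0// => z /mem_rem zD.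
by apply: f0; apply: KM => //; apply: KA; exact: map_f.
Qed.

Lemma continuous_mean (X : topologicalType) (F : X -> G -> R) :
  continuous (fun p : X * G => F p.1 p.2) -> continuous (fun x => mean K (F x)).
Proof.
move=> Fc x0; have [cK _ _ _] := gK.
have Fxc x : continuous (F x).
  by apply: (continuous_pair_comp (f := fun=> x) (g := id) Fc); cont.
apply/cvgrPdist_le => e e0.
move/compact_near_coveringP : cK => cK.
suff : \forall x \near nbhs x0, K `<=` [set k | `|F x0 k - F x k| <= e].
  by apply: filterS => x NK; exact: mean_dist.
apply: cK => k Kk.
have Gc : continuous (fun p : G * X => F x0 p.1 - F p.2 p.1).
  apply: continuous_subr.
    by apply: (continuous_compose (Fxc x0)); cont.
  by apply: (continuous_pair_comp (f := snd) (g := fst) Fc); cont.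
have := @nbhs_distr _ _ _ (k, x0) _ Gc e0.
by apply: filterS => -[k' x] /=; rewrite subrr sub0r normrN.
Qed.

End MeanDef.

Section Fubini.
Variables (R : realType) (G : topGroupType).

(** The inner mean over [L] is replaced by a finite average, uniformly in [x] from [K]; finite
    averages commute with the mean over [K]. *)
Lemma mean_exchange (K L : set G) (F : G -> G -> R) :
  compact_subgroup K -> compact_subgroup L ->
  continuous (fun p : G * G => F p.1 p.2) ->
  mean K (fun x => mean L (F x)) = mean L (fun y => mean K (F^~ y)).
Proof.
move=> gK gL Fc; apply/eqP; rewrite -subr_eq0 -normr_le0.
apply/ler_addgt0Pr => e e0; rewrite add0r.
have Fc' : continuous (fun p : G * G => F p.2 p.1).
  by apply: (continuous_pair_comp (f := snd) (g := fst) Fc); cont.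
have Fyc y : continuous (F^~ y).
  by apply: (continuous_pair_comp (f := id) (g := fun=> y) Fc); cont.
have [cK _ _ _] := gK.
have [A LA AP] := mean_uniform gL Fc cK e0.
apply: (mean_approx gL (A := A)) => //.
  exact: (continuous_mean gK (F := fun y x => F x y)).
move=> y Ly; rewrite -(mean_avg gK (H := fun x a => F x (y * a)%g)); first last.
- by move=> a; exact: Fyc.
- by case: LA.
apply: mean_dist => // [||x Kx].
- exact: continuous_avg.
- exact: (continuous_mean gL).
- exact: AP.
Qed.

End Fubini.

(** * Hausdorff separation in the constructions and in hyperspaces *)

Section Hausdorff.

Lemma hausdorff_continuous_eq (X Y : topologicalType) (f : X -> Y) p q :
  hausdorff_space Y -> continuous f -> cluster (nbhs p) q -> f p = f q.
Proof.
move=> hY fc pq; apply: hY => A B fpA fqB.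
by have [z [Az Bz]] := pq _ _ (fc p _ fpA) (fc q _ fqB); exists (f z).
Qed.

Lemma hausdorff_disjoint_nbhs (X : topologicalType) (p q : X) :
  hausdorff_space X -> p <> q ->
  exists A B, [/\ nbhs p A, nbhs q B & forall z, A z -> B z -> False].
Proof.
move=> hX pq; apply: contrapT => noAB; apply/pq/hX => A B pA qB.
apply: contrapT => AB0; apply: noAB; exists A, B; split=> // z Az Bz.
by apply: AB0; exists z.
Qed.

Lemma nbhs_neq (X Y : topologicalType) (f g : X -> Y) p : hausdorff_space Y ->
  continuous f -> continuous g -> f p <> g p -> nbhs p [set z | f z <> g z].
Proof.
move=> hY fc gc /(hausdorff_disjoint_nbhs hY)[A [B [fpA gpB AB]]].
apply: (@filterS2 _ (nbhs p) _ _ _ _ _ (fc p _ fpA) (gc p _ gpB)) => z /= Az Bz fg.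
by apply: (AB (f z) Az); rewrite fg.
Qed.

Lemma closed_eq_fun (X Y : topologicalType) (f g : X -> Y) : hausdorff_space Y ->
  continuous f -> continuous g -> closed [set z | f z = g z].
Proof.
move=> hY fc gc p clp; apply: contrapT => /(nbhs_neq hY fc gc) /clp[z [/= fg]].
exact.
Qed.

Lemma embedding_continuous (X Y : topologicalType) (f : X -> Y) :
  topological_embedding f -> continuous f.
Proof.
move=> [_ oE] x A; rewrite nbhsE => -[B [oB Bx] BA]; apply: (@filterS _ (nbhs x) _ (f @^-1` B)).
  by move=> y; exact: BA.
by apply: open_nbhs_nbhs; split=> //; apply/oE; exists B.
Qed.

Lemma embedding_hausdorff (X Y : topologicalType) (f : X -> Y) :
  topological_embedding f -> hausdorff_space Y -> hausdorff_space X.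
Proof.
move=> fe hY p q pq; have [fI _] := fe; apply: fI.
exact: (hausdorff_continuous_eq hY (embedding_continuous fe) pq).
Qed.

Lemma prod_proj_continuous (I : Type) (S : I -> topSemigroupType) i :
  continuous (fun x : prod_topology S => x i).
Proof.
move=> x A; rewrite nbhsE => -[V [oV Vx] VA].
have /cvg_sup/(_ i) : x --> x by [].
apply; exists [set t : prod_topology S | V (t i)].
by split; [exists V|exact: Vx|move=> t Vt; exact: VA].
Qed.

Lemma prod_hausdorff (I : Type) (S : I -> topSemigroupType) :
  (forall i, hausdorff_space (S i)) -> hausdorff_space (prod_topology S).
Proof.
move=> hS p q pq; apply: functional_extensionality_dep => i.
exact: (hausdorff_continuous_eq (hS i) (@prod_proj_continuous I S i) pq).
Qed.

Lemma semidirect_hausdorff (G : topGroupType) (T : topSemigroupType)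
    (sigma : continuous_action G T) :
  hausdorff_space T -> hausdorff_space (semidirect sigma).
Proof.
move=> hT [t g] [u h] pq.
rewrite (hausdorff_continuous_eq hT (@continuous_fst_proj T G) pq : t = u).
by rewrite (hausdorff_continuous_eq topgroup_hausdorff (@continuous_snd_proj T G) pq : g = h).
Qed.

Lemma attach_zero_nbhs_some (T : topSemigroupType) (t : T) (U : set T) :
  nbhs t U -> nbhs (Some t : attach_zero T) (Some @` U).
Proof.
rewrite nbhsE => -[V [oV Vt] VU]; exists (Some @` V); split.
- rewrite /open /= /zero_open /= (_ : _ @^-1` _ = V) // eqEsubset.
  by split=> [x [z Vz [<-]]|x Vx] //; exists x.
- by exists t.
- exact: image_subset.
Qed.

Lemma attach_zero_nbhs_none (T : topSemigroupType) :
  nbhs (None : attach_zero T) [set None].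
Proof.
exists [set None]; split=> //.
by rewrite /open /= /zero_open /= (_ : _ @^-1` _ = set0) ?eqEsubset; [exact: open0|split].
Qed.

Lemma some_continuous (T : topSemigroupType) : continuous (Some : T -> attach_zero T).
Proof.
move=> t A [B [oB Bt BA]]; apply: (@filterS _ (nbhs t) _ (Some @^-1` B)).
  by move=> u /BA.
exact: open_nbhs_nbhs.
Qed.

Lemma attach_zero_hausdorff (T : topSemigroupType) :
  hausdorff_space T -> hausdorff_space (attach_zero T).
Proof.
move=> hT [p|] [q|] pq //.
- congr Some; apply: hT => A B pA qB.
  have [_ [[a Aa <-] [b Bb [ba]]]] := pq _ _ (attach_zero_nbhs_some pA) (attach_zero_nbhs_some qB).
  by exists a; split=> //; rewrite -ba.
- have [_ [[a _ <-] //]] := pq _ _ (attach_zero_nbhs_some (@filterT _ (nbhs p) _)) (@attach_zero_nbhs_none T).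
- have [_ [-> [a _ //]]] := pq _ _ (@attach_zero_nbhs_none T) (attach_zero_nbhs_some (@filterT _ (nbhs q) _)).
Qed.

Lemma hausdorff_compact_disjoint_nbhs (X : topologicalType) (K : set X) x :
  hausdorff_space X -> compact K -> ~ K x -> exists V W,
    [/\ nbhs x V, open W, K `<=` W & forall z, V z -> W z -> False].
Proof.
move=> hX cK nKx; have [->|/set0P K0] := eqVneq K set0.
  by exists setT, set0; split=> //; [exact: filterT|exact: open0].
have [|_ y -> Ky|V [W [xV KW VW]]] := compact_prod_nbhs (K := [set x])
    (O := [set p | p.1 <> p.2]) _ cK K0.
- exact: compact_set1.
- apply: (@nbhs_neq _ _ (@fst X X) (@snd X X) (x, y)) => //.
  + exact: continuous_fst_proj.
  + exact: continuous_snd_proj.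
  + by move=> /= xy; apply: nKx; rewrite xy.
have [W' [oW' KW' W'W]] := (set_nbhsP _ _).1 KW.
exists V, W'; split=> //; first exact: xV.
by move=> z Vz /W'W Wz; apply: (VW (z, z)).
Qed.

Lemma hyperspace_hausdorff (G : topGroupType) : hausdorff_space (hyperspace G).
Proof.
have main (A B : hyperspace G) x : cluster (nbhs A) B -> hset A x -> hset B x.
  move=> AB Ax; apply: contrapT => nBx; have [_ cB] := hsetP B.
  have [V [W [xV oW BW VW]]] := hausdorff_compact_disjoint_nbhs (@topgroup_hausdorff G) cB nBx.
  have [K [[z [Kz Vz]] KW]] : (vietoris_lower (interior V) `&` vietoris_upper W) !=set0.
    apply: AB; apply: open_nbhs_nbhs; split.
    - by apply: vietoris_openP; right; exists (interior V) => //; exact: open_interior.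
    - by exists x; split=> //; exact: nbhs_singleton (nbhs_interior xV).
    - by apply: vietoris_openP; left; exists W.
    - exact: BW.
  by apply: (VW z); [exact: interior_subset|exact: KW].
move=> A B AB; apply: hset_inj; rewrite eqEsubset; split=> x; apply: main => //.
by move=> P Q BP AQ; rewrite setIC; exact: AB.
Qed.

End Hausdorff.

(** * Projections on invariant functions and convolutions *)

Section Projections.
Variables (R : realType) (G : topGroupType).
Implicit Types (f g : G -> R) (K L N M : set G).

Definition invproj K f : G -> R := fun x => mean K (fun k => f (x * k)%g).

Lemma continuous_translate f x : continuous f -> continuous (fun y => f (x * y)%g).
Proof. by move=> fc; apply: (continuous_compose fc); cont. Qed.

Lemma continuous_translate2 f : continuous f -> continuous (fun p : G * G => f (p.1 * p.2)%g).
Proof. by move=> fc; apply: (continuous_compose fc); cont. Qed.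

Lemma continuous_invproj K f : compact_subgroup K -> continuous f -> continuous (invproj K f).
Proof. by move=> gK fc; apply: continuous_mean => //; by apply: continuous_translate2. Qed.

Lemma invprojB K f g : compact_subgroup K -> continuous f -> continuous g ->
  invproj K (fun x => f x - g x) = (fun x => invproj K f x - invproj K g x).
Proof.
move=> gK fc gc; apply/funext => x.
by rewrite /invproj (meanB gK (f := fun k => f (x * k)%g))//; by apply: continuous_translate.
Qed.

Lemma invproj_translate K f x l : compact_subgroup K -> continuous f -> K l ->
  invproj K f (x * l)%g = invproj K f x.
Proof.
move=> gK fc Kl; rewrite /invproj -[RHS](mean_mull gK (k := l))//.
  by congr mean; apply/funext => k; rewrite mulgA.
by apply: continuous_translate.
Qed.

(** With [F n = invproj L f (x n)], both sides equal the double mean of [F (k n)] over [K] and [N].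
    Invariance of the mean over [N] removes [k]; writing [n = k' l], the [L]-invariance of [F]
    removes [l] and the mean over [K] removes [k']. *)
Lemma invproj_comp K L f : compact_subgroup K -> compact_subgroup L ->
  compact_subgroup (prod_set K L) -> continuous f ->
  invproj K (invproj L f) = invproj (prod_set K L) f.
Proof.
move=> gK gL; set N := prod_set K L => gN fc; apply/funext => x.
have [_ K1 KM _] := gK; have [_ L1 LM _] := gL.
have LN l : L l -> N l by move=> Ll; exists 1%g => //; exists l; rewrite // mul1g.
have KN k : K k -> N k by move=> Kk; exists k => //; exists 1%g; rewrite // mulg1.
pose F n := invproj L f (x * n)%g.
have Fc : continuous F by apply: continuous_translate; exact: continuous_invproj.
have -> : invproj (prod_set K L) f x = mean N F.
  rewrite /F /invproj mean_exchange//; last first.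
    by apply: (continuous_compose fc); cont.
  rewrite -[LHS](mean_cst gL); apply: eq_mean => //.
  - exact: cst_continuous.
  - have gc : continuous (fun p : G * G => f (x * p.2 * p.1)%g).
      by apply: (continuous_compose fc); cont.
    exact: (continuous_mean gN gc).
  move=> l Ll; rewrite -(mean_mulr gN (continuous_translate (x := x) fc) (LN l Ll)).
  by congr mean; apply/funext => n; rewrite mulgA.

rewrite -[RHS](mean_cst gK).
have Fc2 : continuous (fun p : G * G => F (p.1 * p.2)%g).
  by apply: (continuous_compose Fc); cont.
transitivity (mean K (fun k => mean N (fun n => F (k * n)%g))); last first.
  apply: eq_mean => //.
  - exact: (continuous_mean gN (F := fun k n => F (k * n)%g)).
  - exact: cst_continuous.
  by move=> k Kk; apply: mean_mull => //; exact: KN.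
rewrite mean_exchange// -[LHS](mean_cst gN); apply: eq_mean => //.
- exact: cst_continuous.
- apply: (continuous_mean gK (F := fun y x0 => F (x0 * y)%g)).
  by apply: (continuous_compose Fc); cont.
move=> _ [k' Kk' [l Ll <-]].
rewrite -[LHS](mean_mulr gK Fc Kk').
by congr mean; apply/funext => k; rewrite /F !mulgA [RHS]invproj_translate.
Qed.

Variables (M : set G) (gM : compact_subgroup M).

Definition normsq f := mean M (fun x => f x * f x).

Lemma normsq_ge0 f : continuous f -> 0 <= normsq f.
Proof.
move=> fc; apply: mean_ge0 => // [|x _]; first exact: continuous_mulr.
by rewrite -expr2 sqr_ge0.
Qed.

(** After exchanging the means, substitute [x k] for [x] in the mean over [M], which is allowed as
    [K] lies in [M], and [k^-1] for [k] in the mean over [K]. *)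
Lemma invproj_adjoint K f g : compact_subgroup K -> K `<=` M ->
  continuous f -> continuous g ->
  mean M (fun x => invproj K f x * g x) = mean M (fun x => f x * invproj K g x).
Proof.
move=> gK KM fc gc.
have f2 := continuous_translate2 fc; have g2 := continuous_translate2 gc.
have cgV : continuous (fun p : G * G => g (p.1 * p.2^-1)%g).
  by apply: (continuous_compose gc); cont.
have fcx x := @continuous_translate f x fc.
have gcx x := @continuous_translate g x gc.
have f1 : continuous (fun p : G * G => f p.1) by apply: (continuous_compose fc); cont.
have g1 : continuous (fun p : G * G => g p.1) by apply: (continuous_compose gc); cont.
transitivity (mean M (fun x => mean K (fun k => f (x * k)%g * g x))).
  congr mean; apply/funext => x; rewrite mulrC /invproj -meanZ//.
  by congr mean; apply/funext => k; rewrite mulrC.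
transitivity (mean M (fun x => mean K (fun k => f x * g (x * k^-1)%g))); last first.
  congr mean; apply/funext => x; rewrite /invproj meanZ; first last.
  - by apply: (continuous_compose (gcx x)); cont.
  - by [].
  by rewrite (mean_inv gK (f := fun k => g (x * k)%g)).
rewrite mean_exchange//; last by cont.
rewrite [RHS]mean_exchange//; last by cont.
have swap (H : G * G -> R) : continuous H -> continuous (fun p : G * G => H (p.2, p.1)).
  by move=> Hc; apply: (continuous_pair_comp (f := snd) (g := fst) Hc); cont.
apply: eq_mean => //.
- apply: (continuous_mean gM (F := fun y x => f (x * y)%g * g x)).
  by apply: (swap (fun p => f (p.1 * p.2)%g * g p.1)); cont.
- apply: (continuous_mean gM (F := fun y x => f x * g (x * y^-1)%g)).
  by apply: (swap (fun p => f p.1 * g (p.1 * p.2^-1)%g)); cont.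
move=> k /KM Mk; rewrite -[RHS](mean_mulr gM (k := k))//.
  by congr mean; apply/funext => x; rewrite mulgK.
apply: continuous_mulr => //; apply: (continuous_compose gc); cont.
Qed.

Lemma invproj_idem K f : compact_subgroup K -> continuous f -> invproj K (invproj K f) = invproj K f.
Proof.
move=> gK fc; have [_ K1 KM KV] := gK.
have E : prod_set K K = K.
  rewrite eqEsubset; split=> [_ [x Kx [y Ky <-]]|x Kx]; first exact: KM.
  by exists x => //; exists 1%g; rewrite // mulg1.
by rewrite invproj_comp// E.
Qed.

Lemma invproj_orthogonal K f g : compact_subgroup K -> K `<=` M ->
  continuous f -> continuous g ->
  mean M (fun x => (f x - invproj K f x) * invproj K g x) = 0.
Proof.
move=> gK KM fc gc.
have pfc := continuous_invproj gK fc; have pgc := continuous_invproj gK gc.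
have fpc : continuous (fun x => f x - invproj K f x) by cont.
rewrite -invproj_adjoint// invprojB// invproj_idem//.
rewrite -[RHS](mean_cst gM); congr (mean M); apply/funext => x.
by rewrite subrr mul0r.
Qed.

Lemma pythagoras (u v : G -> R) : continuous u -> continuous v -> mean M (fun x => u x * v x) = 0 ->
  normsq (fun x => u x + v x) = normsq u + normsq v.
Proof.
move=> uc vc uv0; rewrite /normsq.
have -> : (fun x => (u x + v x) * (u x + v x)) =
    (fun x => (u x * u x + v x * v x) + 2 * (u x * v x)).
  by apply/funext => x; ring.
rewrite mean_linear//; last 2 first.
- by cont.
- by cont.
by rewrite uv0 mulr0 addr0 meanD//; cont.
Qed.

Section CommutingOperator.
Variable T : (G -> R) -> G -> R.
Hypothesis Tc : forall f, continuous f -> continuous (T f).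
Hypothesis TB : forall f g, continuous f -> continuous g ->
  T (fun x => f x - g x) = (fun x => T f x - T g x).

(** An operator bound, required for all [f] at once: for a product of subgroups it is applied to
    [f - invproj K f] and to [invproj K f] separately. Norms are squared so that orthogonal parts
    add up. *)
Definition nearly_fixed K (e : R) : Prop := forall f, continuous f ->
  normsq (fun x => T f x - invproj K (T f) x) <= e * normsq f.

(* With [Q_K = 1 - invproj K] and [N = K L], [Q_N = Q_K + invproj K Q_L] is an orthogonal sum,
   and [Q_N T f] splits along [f = Q_K f + invproj K f]: the bound does not deteriorate. *)
Lemma nearly_fixed_prod K L e :
  compact_subgroup K -> compact_subgroup L -> compact_subgroup (prod_set K L) ->
  prod_set K L = prod_set L K -> K `<=` M ->
  (forall f, continuous f -> invproj K (T f) = T (invproj K f)) ->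
  nearly_fixed K e -> nearly_fixed L e -> nearly_fixed (prod_set K L) e.
Proof.
move=> gK gL gN KL KM TK eK eL f fc.
have gN' : compact_subgroup (prod_set L K) by rewrite -KL.
have Tfc := Tc fc; have pKc := continuous_invproj gK fc.
have pTKc := continuous_invproj gK Tfc; have pTLc := continuous_invproj gL Tfc.
pose f1 x := f x - invproj K f x.
have f1c : continuous f1 by rewrite /f1; cont.
pose u x := T f1 x - invproj K (T f1) x.
pose v x := T (invproj K f) x - invproj L (T (invproj K f)) x.
have uE : u = (fun x => T f x - invproj K (T f) x).
  apply/funext => x; rewrite /u /f1 TB// invprojB//; last exact: Tc.
  by rewrite -TK// invproj_idem// subrr subr0.
have vE : v = invproj K (fun x => T f x - invproj L (T f) x).
  by rewrite invprojB// [invproj K (invproj L _)]invproj_comp// KL -invproj_comp// TK.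
have uc : continuous u by rewrite uE; cont.
have vc : continuous v by rewrite vE; apply: continuous_invproj => //; cont.
have -> : (fun x => T f x - invproj (prod_set K L) (T f) x) = (fun x => u x + v x).
  by apply/funext => x; rewrite uE vE invprojB// invproj_comp//; ring.
rewrite pythagoras//; last first.
  by rewrite uE vE invproj_orthogonal//; cont.
have -> : normsq f = normsq f1 + normsq (invproj K f).
  rewrite -pythagoras//; last exact: invproj_orthogonal.
  by congr normsq; apply/funext => x; rewrite subrK.
by rewrite mulrDr lerD ?eK ?eL.
Qed.

End CommutingOperator.

End Projections.

Section Convolution.
Variables (R : realType) (G : topGroupType).
Implicit Types (f g : G -> R) (K L N M : set G).
Variables (M : set G) (gM : compact_subgroup M).
Variables (phi : G -> R) (phic : continuous phi).

Definition gconv f : G -> R := fun x => mean M (fun y => phi (x * y^-1)%g * f y).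

Lemma continuous_gconv f : continuous f -> continuous (gconv f).
Proof.
move=> fc; apply: continuous_mean => //; apply: continuous_mulr.
  by apply: (continuous_compose phic); cont.
by apply: (continuous_compose fc); cont.
Qed.

Lemma continuous_phiV x : continuous (fun y => phi (x * y^-1)%g).
Proof. by apply: (continuous_compose phic); cont. Qed.

Lemma gconvB f g : continuous f -> continuous g ->
  gconv (fun x => f x - g x) = (fun x => gconv f x - gconv g x).
Proof.
move=> fc gc; apply/funext => x; have px := @continuous_phiV x.
rewrite /gconv -meanB//; [|by cont..].
by congr mean; apply/funext => y; rewrite mulrBr.
Qed.

Definition avg_kernel K (x y : G) := mean K (fun k => phi (x * k * y^-1)%g).

Lemma continuous_avg_kernel K : compact_subgroup K ->
  continuous (fun p : G * G => avg_kernel K p.1 p.2).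
Proof.
move=> gK; apply: (continuous_mean gK (F := fun p k => phi (p.1 * k * p.2^-1)%g)).
by apply: (continuous_compose phic); cont.
Qed.

Lemma invproj_gconv_kernel K f x : compact_subgroup K -> continuous f ->
  invproj K (gconv f) x = mean M (fun y => avg_kernel K x y * f y).
Proof.
move=> gK fc; rewrite /invproj /gconv.
have pkc y : continuous (fun k => phi (x * k * y^-1)%g).
  by apply: (continuous_compose phic); cont.
rewrite mean_exchange//; last first.
  apply: continuous_mulr; last by apply: (continuous_compose fc); cont.
  by apply: (continuous_compose phic); cont.
congr mean; apply/funext => y; rewrite mulrC /avg_kernel -meanZ//.
by congr mean; apply/funext => k; rewrite mulrC.
Qed.

(** The projection acts by right translation, and the substitution of [y k] for [y] in the mean over
    [M] moves it past the kernel, which depends on [x y^-1] only. *)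
Lemma invproj_gconv K f : compact_subgroup K -> K `<=` M -> continuous f ->
  invproj K (gconv f) = gconv (invproj K f).
Proof.
move=> gK KM fc; apply/funext => x; have px := @continuous_phiV x.
transitivity (mean M (fun y => mean K (fun k => phi (x * y^-1)%g * f (y * k)%g))); last first.
  congr mean; apply/funext => y; rewrite /invproj meanZ//; exact: (@continuous_translate _ _ f y fc).
rewrite [RHS]mean_exchange//; last first.
  apply: continuous_mulr; last by apply: continuous_translate2.
  by apply: (continuous_compose px); cont.
have pf2 : continuous (fun p : G * G => f (p.2 * p.1)%g).
  by apply: (continuous_compose fc); cont.
apply: eq_mean => //.
- apply: continuous_translate; exact: continuous_gconv.
- apply: (continuous_mean gM (F := fun k y => phi (x * y^-1)%g * f (y * k)%g)).
  by apply: continuous_mulr => //; apply: (continuous_compose px); cont.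
move=> k /KM Mk.
have xkc : continuous (fun y => phi (x * k * y^-1)%g * f y).
  by apply: continuous_mulr => //; exact: (@continuous_phiV (x * k)%g).
rewrite /gconv -(mean_mulr gM xkc Mk).
by congr mean; apply/funext => y; rewrite invgM mulgA mulgK.
Qed.

Lemma sqr_mean_le f : continuous f -> mean M (fun x => `|f x|) ^+ 2 <= normsq M f.
Proof.
move=> fc; have afc : continuous (fun x => `|f x|).
  by apply: (continuous_compose (@norm_continuous R R)).
pose c := mean M (fun x => `|f x|).
(* The mean of the square of [|f x| - c]: this is Cauchy-Schwarz against the constant 1. *)
have : 0 <= mean M (fun x => (f x * f x + c ^+ 2) + (- 2 * c) * `|f x|).
  apply: mean_ge0 => // [|x _]; first by cont.
  rewrite (_ : _ + _ = (`|f x| - c) ^+ 2) ?sqr_ge0// sqrrB real_normK ?num_real//.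
  by rewrite expr2; ring.
rewrite mean_linear//; [|by cont..].
rewrite meanD//; [|by cont..].
by rewrite mean_cst// -/c /normsq; nra.
Qed.

(** Smoothing turns uniform nearness of two kernels on [M] into a bound for all [f]: pointwise on
    [M] the difference is at most [e] times the mean of [|f|]. *)
Lemma normsq_kernel_le H N f (e : R) :
  compact_subgroup H -> compact_subgroup N ->
  continuous f -> 0 <= e ->
  (forall x y, M x -> M y -> `|avg_kernel H x y - avg_kernel N x y| <= e) ->
  normsq M (fun x => invproj H (gconv f) x - invproj N (gconv f) x)
    <= e ^+ 2 * normsq M f.
Proof.
move=> gH gN fc e0 HN.
have afc : continuous (fun x => `|f x|).
  by apply: (continuous_compose (@norm_continuous R R)).
have kc K x : compact_subgroup K -> continuous (avg_kernel K x).
  move=> gK; apply: (continuous_pair_comp (f := fun=> x) (g := id) (continuous_avg_kernel gK)); cont.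
pose c := mean M (fun x => `|f x|).
apply: (@le_trans _ _ (e ^+ 2 * c ^+ 2)); last first.
  by rewrite ler_wpM2l ?sqr_ge0// sqr_mean_le.
have pc K : compact_subgroup K -> continuous (invproj K (gconv f)).
  by move=> gK; apply: continuous_invproj => //; exact: continuous_gconv.
have pHc := pc _ gH; have pNc := pc _ gN.
rewrite /normsq -[leRHS](mean_cst gM); apply: mean_le => //.
- by cont.
- exact: cst_continuous.
move=> x Mx; rewrite !invproj_gconv_kernel//.
have kHc := kc _ x gH; have kNc := kc _ x gN.
rewrite -meanB//; [|by cont..].
set m := mean _ _; have : `|m| <= e * c.
  rewrite ler_norml; apply/andP; split.
    rewrite lerNl -mulN1r -meanZ//; last by cont.
    rewrite /c -meanZ//; apply: mean_le => //; [by cont..|].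
    move=> y My; have := HN x y Mx My; rewrite -mulrBl mulrA mulN1r => kHN.
    by rewrite (le_trans (ler_norm _))// normrM normrN ler_wpM2r.
  rewrite /c -meanZ//; apply: mean_le => //; [by cont..|].
  move=> y My; have := HN x y Mx My; rewrite -mulrBl => kHN.
  by rewrite (le_trans (ler_norm _))// normrM ler_wpM2r.
move=> mec; have ec0 : 0 <= e * c by exact: le_trans mec.
by rewrite -exprMn -expr2 -[m ^+ 2]real_normK ?num_real// ler_sqr ?nnegrE.
Qed.

End Convolution.

Lemma filter_forall_seq (T : Type) (F : set_system T) (I : choiceType) (s : seq I)
    (P : I -> set T) : Filter F ->
  (forall i, i \in s -> F (P i)) -> F [set t | forall i, i \in s -> P i t].
Proof.
move=> FF; elim: s => [|i s IH] FP; first by apply: filterS filterT.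
have Fi : F (P i) by apply: FP; rewrite inE eqxx.
have Fs : F [set t | forall i, i \in s -> P i t].
  by apply: IH => j js; apply: FP; rewrite inE js orbT.
apply: filterS2 Fi Fs => t Pit Pst j; rewrite inE => /orP[/eqP->//|]; exact: Pst.
Qed.

(** An averaging sequence [A] of [hset H] is moved into [K]. The lower Vietoris sets provide a point
    of [K] near each [a], the upper one a point of [hset H] near each [k] in [K], so the moved
    averages stay nearly constant on [K]. *)
Lemma mean_hyperspace_continuous (R : realType) (G : topGroupType)
    (X : topologicalType) (F : X -> G -> R) (C : set X) (H : hyperspace G) e :
  continuous (fun p : X * G => F p.1 p.2) -> compact C -> compact_subgroup (hset H) ->
  0 < e ->
  nbhs H [set K : hyperspace G | compact_subgroup (hset K) ->
    forall x, C x -> `|mean (hset H) (F x) - mean (hset K) (F x)| <= e].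
Proof.
move=> Fc cC gH e0; have e20 : 0 < e / 2 by rewrite divr_gt0.
have [cH H1 HM HV] := gH.
have [->|/set0P[x0 Cx0]] := eqVneq C set0.
  by apply: filterE => K _ x [].
have [A [A0 HA] AP] := mean_uniform gH Fc cC e20.
(* The perturbations [w] and [w'] will be [h^-1 k] and [a^-1 b] for points [k], [b] of [K] near [h],
   [a]; thus [h w a w'] is [k b]. *)
have [||| [w w'] [x [h a]] [-> ->] [/= Cx [/= Hh Ha]]|V [L [V1 nL VL]]] :=
    @compact_prod_nbhs (G * G)%type (X * (G * G))%type [set (1%g, 1%g)]
    (C `*` (hset H `*` hset H))
    [set p | `|F p.2.1 (p.2.2.1 * p.1.1 * p.2.2.2 * p.1.2)%g - F p.2.1 (p.2.2.1 * p.2.2.2)%g| <= e / 2].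
- exact: compact_set1.
- exact: (compact_setX cC (compact_setX cH cH)).
- by exists (x0, (1%g, 1%g)); do 2?split.
- pose D (p : (G * G) * (X * (G * G))) : R :=
    F p.2.1 (p.2.2.1 * p.1.1 * p.2.2.2 * p.1.2)%g - F p.2.1 (p.2.2.1 * p.2.2.2)%g.
  have Dc : continuous D.
    apply: continuous_subr.
      apply: (continuous_pair_comp (f := fun p : (G * G) * (X * (G * G)) => p.2.1)
        (g := fun p : (G * G) * (X * (G * G)) => (p.2.2.1 * p.1.1 * p.2.2.2 * p.1.2)%g) Fc); cont.
    apply: (continuous_pair_comp (f := fun p : (G * G) * (X * (G * G)) => p.2.1)
        (g := fun p : (G * G) * (X * (G * G)) => (p.2.2.1 * p.2.2.2)%g) Fc); cont.
  have := @nbhs_distr _ _ _ ((1%g, 1%g), (x, (h, a))) _ Dc e20.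
  by apply: filterS => p; rewrite {1}/D /= !mulg1 subrr sub0r normrN.
have {V1} [[W1 W2] [/= W11 W21] WV] : nbhs ((1%g : G), (1%g : G)) V by exact: V1.
pose W : set G := interior (W1 `&` W2).
have oW : open W by exact: open_interior.
have W_1 : W 1%g by apply: nbhs_singleton; apply: nbhs_interior; exact: filterI.
have WW w : W w -> W1 w /\ W2 w by move=> /interior_subset.
have Wo (a : G) : open [set x | W (a^-1 * x)%g].
  by apply: open_comp => // x _; apply: (@continuous_mulg _ G (fun=> a^-1%g) id); cont.
have near_lower : nbhs H [set K : hyperspace G | forall a, a \in A ->
    vietoris_lower [set x | W (a^-1 * x)%g] K].
  apply: filter_forall_seq => a /HA Ha; apply: open_nbhs_nbhs; split.
    by apply: vietoris_openP; right; exists [set x | W (a^-1 * x)%g].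
  by exists a; split => //=; rewrite mulVg.
pose U := [set x | exists2 h, hset H h & W (h^-1 * x)%g].
have near_upper : nbhs H (vietoris_upper U).
  apply: open_nbhs_nbhs; split.
    apply: vietoris_openP; left; exists U => //.
    rewrite (_ : U = \bigcup_(h in hset H) [set x | W (h^-1 * x)%g]).
      by apply: bigcup_open => h _; exact: Wo.
    by rewrite eqEsubset; split=> x [h Hh Wx]; exists h.
  by move=> x Hx; exists x => //; rewrite mulVg.
apply: filterS2 near_lower near_upper => K lowK upK gK x Cx.
have /choice[c cP] : forall a, exists b, a \in A -> hset K b /\ W (a^-1 * b)%g.
  move=> a; have [/lowK[b [Kb Wb]]|_] := boolP (a \in A); last by exists a.
  by exists b.
apply: (@mean_approx _ _ _ gK [seq c a | a <- A]).
- by apply: (continuous_pair_comp (f := fun=> x) (g := id) Fc); cont.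
- split; first by case: (A) A0.
  by move=> _ /mapP[a /cP[Kca _] ->].
move=> k Kk; have [h Hh Wk] := upK k Kk.
have -> : avg [seq c a | a <- A] (fun a => F x (k * a)%g) = avg A (fun a => F x (k * c a)%g).
  by rewrite /avg size_map big_map.
rewrite (le_trans (ler_distD (avg A (fun a => F x (h * a)%g)) _ _))// [leRHS]splitr.
rewrite lerD// ?AP//; apply: avg_dist2 => // a Aa; have [Kca Wca] := cP a Aa.
have W1k : W1 (h^-1 * k)%g by case: (WW _ Wk).
have W2a : W2 (a^-1 * c a)%g by case: (WW _ Wca).
have := VL ((h^-1 * k, a^-1 * c a)%g, (x, (h, a))).
rewrite /= !mulgA mulgV mul1g mulgK; apply; split => /=; first exact: WV.
have xha : (C `*` (hset H `*` hset H)) (x, (h, a)).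
  by split => //; split => //; exact: HA.
by have /nbhs_singleton := nL _ xha.
Qed.

(** * Semilattices of idempotents in the constructions of [class_H0] *)

Section Semilattices.
Local Open Scope group_scope.

Definition subsemilattice (S : topSemigroupType) (E : set S) : Prop :=
  [/\ forall x, E x -> x * x = x, forall x y, E x -> E y -> x * y = y * x &
      subsemigroup E].

Lemma semilattice_lower_bound (S : topSemigroupType) (E : set S) x0 (s : seq S) :
  subsemilattice E -> E x0 -> {in s, forall x, E x} ->
  exists2 m, E m & m * x0 = m /\ {in s, forall x, m * x = m}.
Proof.
move=> [Ei Ec EM] Ex0; elim: s => [_|x s IH sE]; first by exists x0 => //; split=> //; exact: Ei.
have Ex : E x by apply: sE; rewrite inE eqxx.
have [|m Em [mx0 ms]] := IH; first by move=> y ys; apply: sE; rewrite inE ys orbT.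
have mxy y : E y -> m * y = m -> m * x * y = m * x.
  by move=> Ey my; rewrite -mulgA (Ec _ _ Ex Ey) mulgA my.
exists (m * x); first exact: EM.
split=> [|y]; first exact: mxy.
rewrite inE => /orP[/eqP->|ys]; first by rewrite -mulgA Ei.
by apply: mxy (ms _ ys); apply: sE; rewrite inE ys orbT.
Qed.

(** Otherwise each [m] in [E] has some [x] with [m * x <> m], an open condition on [m]; a common
    lower bound of finitely many such [x] contradicts all of these conditions. *)
Lemma compact_semilattice_min (S : topSemigroupType) (E : set S) :
  hausdorff_space S -> compact E -> subsemilattice E -> E !=set0 ->
  exists2 m, E m & forall x, E x -> m * x = m.
Proof.
move=> hS cE lE [x0 Ex0]; apply: contrapT => nomin.
have [m Em|s sE sN] := compact_finite_nbhs_cover (P := E)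
    (N := fun x => [set m | m * x <> m]) cE.
  apply: contrapT => mE; apply: nomin; exists m => // x Ex.
  apply: contrapT => mx; apply: mE; exists x => //.
  have cx : continuous (fun y : S => y * x) by cont.
  have ci : continuous (fun y : S => y) by cont.
  exact: (nbhs_neq hS cx ci).
have [m Em [_ ms]] := semilattice_lower_bound lE Ex0 sE.
by have [x xs /=] := sN m Em; rewrite ms.
Qed.

Lemma closure_subsemigroup (S : topSemigroupType) (A : set S) :
  subsemigroup A -> subsemigroup (closure A).
Proof.
move=> AM x y clx cly N xyN.
have [[P Q] /= [xP yQ] PQN] := @mulg_continuous S (x, y) N xyN.
have [[a [Aa Pa]] [b [Ab Qb]]] := (clx P xP, cly Q yQ).
by exists (a * b); split; [exact: AM|exact: (PQN (a, b))].
Qed.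

(* [e * x <> e] says that [x] does not lie above [e] in the semilattice order. *)
Definition separated_from (S : topSemigroupType) (E : set S) (e x : S) : Prop :=
  exists C N, [/\ closed C, nbhs e N, E `&` N `<=` C, subsemigroup (E `&` C) & ~ C x].

Definition small_separated (S : topSemigroupType) : Prop :=
  forall E : set S, compact E -> subsemilattice E ->
  forall e x, E e -> E x -> e * x <> e -> separated_from E e x.

(** Multiplicativity is asked on [E] only: the first projection of a semidirect product is
    multiplicative on idempotents, whose group coordinate is 1, but in general not elsewhere. *)
Lemma separated_from_preimage (S T : topSemigroupType) (E : set S) (f : S -> T) e x :
  compact E -> subsemilattice E -> small_separated T -> continuous f ->
  (forall x y, E x -> E y -> f (x * y) = f x * f y) ->
  E e -> E x -> f (e * x) <> f e -> separated_from E e x.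
Proof.
move=> cE [Ei Ec EM] sepT fc fM Ee Ex fex.
have [|||||C [N [cC eN ENC CM nCx]]] := sepT (f @` E) _ _ (f e) (f x).
- by apply: continuous_compact => //; exact: continuous_subspaceT.
- split.
  + by move=> _ [y Ey <-]; rewrite -fM// Ei.
  + by move=> _ _ [y Ey <-] [z Ez <-]; rewrite -!fM// Ec.
  + by move=> _ _ [y Ey <-] [z Ez <-]; rewrite -fM//; exists (y * z) => //; exact: EM.
- by exists e.
- by exists x.
- by rewrite -fM.
exists (f @^-1` C), (f @^-1` N); split.
- by apply: closed_comp => // y _; exact: fc.
- exact: fc.
- by move=> y [Ey Ny]; apply: ENC; split=> //; exists y.
- move=> y z [Ey Cy] [Ez Cz]; split; first exact: EM.
  have fE t : E t -> (f @` E) (f t) by exists t.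
  rewrite /= fM//; have fyz : (f @` E `&` C) (f y * f z).
    by apply: CM; split=> //; exact: fE.
  by case: fyz.
- exact: nCx.
Qed.

Lemma embedding_separated (I : Type) (S : I -> topSemigroupType) (T : topSemigroupType) :
  embeds T (prod_topology S) -> (forall i, small_separated (S i)) -> small_separated T.
Proof.
move=> [f fM fe] sepS E cE lE e x Ee Ex ex.
have [i fi] : exists i, f (e * x) i <> f e i.
  apply: contrapT => fi; apply: ex; have [fI _] := fe; apply: fI.
  apply: functional_extensionality_dep => i; apply: contrapT => fi'.
  by apply: fi; exists i.
apply: (@separated_from_preimage _ (S i) _ (fun z => f z i)) => //.
  by apply: (continuous_compose (@prod_proj_continuous I S i)); exact: embedding_continuous.
by move=> y z _ _; rewrite fM.
Qed.

Lemma embedding_separated1 (S T : topSemigroupType) :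
  embeds T S -> small_separated S -> small_separated T.
Proof.
move=> [f fM fe] sepS E cE lE e x Ee Ex ex.
apply: (@separated_from_preimage _ S _ f) => //.
- exact: embedding_continuous.
- by have [fI _] := fe; move=> /fI.
Qed.

Lemma attach_zero_separated (T : topSemigroupType) :
  small_separated T -> small_separated (attach_zero T).
Proof.
move=> sepT E cE [Ei Ec EM] [e|] [x|] Ee Ex ex //; last first.
  (* Here [x] is the zero, and the nonzero elements form a clopen subsemigroup. The case where [e]
     is the zero is excluded by [ex]. *)
  exists (range Some), (range Some); split.
  - move=> [t _|]; first by exists t.
    by move=> /(_ _ (@attach_zero_nbhs_none T))[_ [[t _ <-]]].
  - exact: (attach_zero_nbhs_some (@filterT _ (nbhs e) _)).
  - by move=> y [].
  - move=> y z [Ey [t _ ty]] [Ez [u _ uz]]; split; first exact: EM.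
    by exists (t * u) => //; rewrite -ty -uz.
  - by case.
pose E' := Some @^-1` E.
have ex' : e * x <> e by move=> ex'; apply: ex; congr Some.
have cE' : compact E'.
  have /compact_near_coveringP cE2 := cE.
  apply/compact_near_coveringP => I F P FF PF.
  have := cE2 I F (fun i y => if y is Some t then E' t -> P i t else True) FF _.
  move=> H; have {}H : \forall i \near F, E `<=` (fun y => if y is Some t then E' t -> P i t else True).
    apply: H => -[t|] Et.
      have [[A B] /= [tA FB] AB] := PF t Et.
      exists (Some @` A, B); first by split=> //; exact: attach_zero_nbhs_some.
      by move=> [_ i] /= [[u Au <-] Bi] _; exact: (AB (u, i)).
    exists ([set None], setT); first by split; [exact: attach_zero_nbhs_none|exact: filterT].
    by move=> [_ i] /= [-> _].
  by apply: filterS H => i EP t E't; exact: (EP (Some t)).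
have lE' : subsemilattice E'.
  split.
  - by move=> t /Ei [].
  - by move=> t u Et Eu; have [] := Ec _ _ Et Eu.
  - by move=> t u Et Eu; exact: (EM _ _ Et Eu).
have [C [N [cC eN ENC CM nCx]]] := sepT E' cE' lE' e x Ee Ex ex'.
exists (Some @` C), (Some @` N); split.
- move=> [t|] clt; last first.
    by have [_ [[t _ <-]]] := clt _ (@attach_zero_nbhs_none T).
  exists t => //; apply: cC => A tA.
  by have [_ [[c Cc <-] [a Aa [ac]]]] := clt _ (attach_zero_nbhs_some tA); exists c; rewrite -ac in Cc *; split.
- exact: attach_zero_nbhs_some.
- by move=> y [Ey [t Nt ty]]; exists t => //; apply: ENC; split=> //; rewrite /E' /= ty.
- move=> y z [Ey [t Ct ty]] [Ez [u Cu uz]]; split; first exact: EM.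
  subst y z; exists (t * u) => //.
  by have [] := CM t u (conj Ey Ct) (conj Ez Cu).
- by move=> [t Ct [tx]]; apply: nCx; rewrite -tx.
Qed.

Lemma action1 (G : topGroupType) (T : topSemigroupType) (sigma : continuous_action G T) t :
  sigma 1 t = t.
Proof.
have [_ _ [g [gK _ _]]] := action_automorphism sigma 1.
by apply: (can_inj gK); have := actionM sigma 1 1; rewrite mulg1 => /(congr1 (@^~ t)).
Qed.

Lemma semidirect_idempotent (G : topGroupType) (T : topSemigroupType)
    (sigma : continuous_action G T) (x : semidirect sigma) : x * x = x -> x.2 = 1.
Proof. by move=> /(congr1 snd) /= xx; apply: (mulgI x.2); rewrite xx mulg1. Qed.

Lemma semidirect_separated (G : topGroupType) (T : topSemigroupType)
    (sigma : continuous_action G T) :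
  small_separated T -> small_separated (semidirect sigma).
Proof.
move=> sepT E cE lE e x Ee Ex ex; have [Ei _ EM] := lE.
have E1 y : E y -> y.2 = 1 by move=> /Ei/semidirect_idempotent.
apply: (@separated_from_preimage (semidirect sigma) T E (fun z => z.1) e x) => //.
- exact: (@continuous_fst_proj T G).
- by move=> y z /E1 y1 _; rewrite /= y1 action1.
- move=> ex1; apply: ex; have := E1 _ (EM _ _ Ee Ex); have := E1 _ Ee; move: ex1.
  by case: (e * x) => a b; case: (e) => c d /= -> -> ->.
Qed.

(** In a Clifford semigroup every product lies in a subgroup, so there all idempotents commute. The
    subgroup stays a hypothesis because factors of a subdirect product need not be Clifford, whereas
    a subgroup maps to a subgroup of each factor. *)
Definition subgroup_idempotents_commute (S : topSemigroupType) : Prop :=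
  forall (A : set S) e f, e * e = e -> f * f = f -> subgroup A -> A (e * f) ->
  e * f = f * e.

Lemma subgroup_image (S T : topSemigroupType) (f : S -> T) (A : set S) :
  (forall x y, f (x * y) = f x * f y) -> subgroup A -> subgroup (f @` A).
Proof.
move=> fM [AM [e [Ae eA Ainv]]]; split.
  by move=> _ _ [x Ax <-] [y Ay <-]; exists (x * y); [exact: AM|rewrite fM].
exists (f e); split; first by exists e.
  by move=> _ [x /eA[ex xe] <-]; rewrite -!fM ex xe.
move=> _ [x /Ainv[y [Ay xy yx]] <-]; exists (f y).
by split; [exists y|rewrite -fM xy|rewrite -fM yx].
Qed.

Lemma embedding_commute (I : Type) (S : I -> topSemigroupType) (T : topSemigroupType) :
  embeds T (prod_topology S) -> (forall i, subgroup_idempotents_commute (S i)) ->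
  subgroup_idempotents_commute T.
Proof.
move=> [f fM [fI _]] cS A e g ee gg gA Aeg; apply: fI.
apply: functional_extensionality_dep => i.
have fMi x y : f (x * y) i = f x i * f y i by rewrite fM.
rewrite !fMi; apply: (cS i _ (f e i) (f g i) _ _ (subgroup_image fMi gA)).
- by rewrite -fMi ee.
- by rewrite -fMi gg.
- by exists (e * g).
Qed.

Lemma embedding_commute1 (S T : topSemigroupType) :
  embeds T S -> subgroup_idempotents_commute S -> subgroup_idempotents_commute T.
Proof.
move=> [f fM [fI _]] cS A e g ee gg gA Aeg; apply: fI.
rewrite !fM; apply: (cS _ (f e) (f g) _ _ (subgroup_image fM gA)).
- by rewrite -fM ee.
- by rewrite -fM gg.
- by exists (e * g).
Qed.

Lemma attach_zero_commute (T : topSemigroupType) :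
  subgroup_idempotents_commute T -> subgroup_idempotents_commute (attach_zero T).
Proof.
move=> cT A [e|] [g|] // [ee] [gg] [AM [[u|] [Au uA Ainv]]] Aeg; last first.
  by have [] := uA _ Aeg.
congr Some; apply: (cT (Some @^-1` A)) => //; split.
  by move=> x y Ax Ay; exact: (AM _ _ Ax Ay).
exists u; split=> // x Ax; first by have [[ux] [xu]] := uA _ Ax.
by have [[y|] [Ay // [xy] [yx]]] := Ainv _ Ax; exists y.
Qed.

Lemma semidirect_commute (G : topGroupType) (T : topSemigroupType)
    (sigma : continuous_action G T) :
  subgroup_idempotents_commute T -> subgroup_idempotents_commute (semidirect sigma).
Proof.
move=> cT A [e a] [g b] ea gb; move: (semidirect_idempotent ea) (semidirect_idempotent gb).
move=> /= a1 b1; subst a b.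
have M1 (x y : T) h : ((x, 1) : semidirect sigma) * (y, h) = (x * y, h).
  by rewrite [LHS]/(_ * _) /= /semidirect_mul /= action1 mul1g.
move: ea gb; rewrite !M1 => -[ee] [gg] [AM [[u c] [Au uA Ainv]]] Aeg.
(* The unit of [A] is idempotent, so it lies over 1, and the part of [A] over 1 is a subgroup of
   [T]. *)
have c1 : c = 1 by have [+ _] := uA _ Au; exact: semidirect_idempotent.
subst c; congr pair; apply: (cT [set x | A (x, 1)]) => //; split.
  by move=> x y Ax Ay; rewrite /= -M1; exact: AM.
exists u; split=> // x Ax; first by have := uA _ Ax; rewrite !M1 => -[[ux] [xu]].
have [[y h] [Ay]] := Ainv _ Ax; rewrite M1 => -[xy h1]; subst h.
by rewrite M1 => -[yx]; exists y.
Qed.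

End Semilattices.

(** * Idempotents of a hyperspace *)

Section HyperspaceIdempotents.
Variable G : topGroupType.
Implicit Types (H K L : hyperspace G).

Lemma hset_mul H K : hset (H * K)%g = prod_set (hset H) (hset K).
Proof. by []. Qed.

(** The powers of [a] have a cluster point [c]. Among powers near [c], a later one divided by an
    earlier one and by [a] is a power of [a] close to [a^-1]. *)
Lemma compact_semigroup_inv (K : set G) :
  compact K -> (forall x y, K x -> K y -> K (x * y)%g) -> forall a, K a -> K a^-1%g.
Proof.
move=> cK KM a Ka.
have clK : closed K by apply: compact_closed => //; exact: topgroup_hausdorff.
pose pw n := iter n (fun x => x * a)%g a.
have Kpw n : K (pw n) by elim: n => //= n IH; exact: KM.
have pwS n : pw n.+1 = (pw n * a)%g by [].
have pwD n k : pw (n + k).+1 = (pw n * pw k)%g.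
  by elim: k => [|k IH]; rewrite ?addn0// addnS pwS IH [pw k.+1]pwS mulgA.
have [c [Kc cc]] := cK (pw @ \oo) _ (@filterE _ \oo _ _ Kpw).
apply: clK => U aU.
pose h (p : G * G) := (p.1^-1 * p.2 * a^-1)%g.
have hc : continuous h by rewrite /h; cont.
have : nbhs (h (c, c)) U by rewrite /h /= mulVg mul1g.
move=> /hc[[P Q] /= [cP cQ] PQU].
have cPQ : nbhs c (P `&` Q) by exact: filterI.
have later N : exists2 n, (N <= n)%N & (P `&` Q) (pw n).
  have [|x [[n /= Nn <-] PQx]] := cc (pw @` [set n | (N <= n)%N]) _ _ cPQ.
    by exists N => // n Nn; exists n.
  by exists n.
(* Since [pw n] is the power [n + 1], the quotient is the power [m - n - 1], that is
   [pw (m - n - 2)]; this needs [n + 2 <= m]. *)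
have [n _ [Pn _]] := later 0; have [m nm [_ Qm]] := later n.+2.
exists (pw (m - n.+2)%N); split; first exact: Kpw.
have <- : h (pw n, pw m) = pw (m - n.+2)%N; last exact: (PQU (pw n, pw m)).
by rewrite /h /= -{1}(subnKC nm) addSnnS pwD pwS !mulgA mulVg mul1g mulgK.
Qed.

Lemma hyperspace_idempotent_subgroup K : (K * K)%g = K -> compact_subgroup (hset K).
Proof.
move=> KK; have [[a Ka] cK] := hsetP K.
have KM x y : hset K x -> hset K y -> hset K (x * y)%g.
  by move=> Kx Ky; rewrite -KK hset_mul; exists x => //; exists y.
have KV := compact_semigroup_inv cK KM.
by split=> //; rewrite -(mulgV a); apply: KM => //; exact: KV.
Qed.

(** On idempotents the semilattice order is reverse inclusion of compact subgroups. *)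
Lemma idempotent_mul_eq H K : (H * H)%g = H -> (K * K)%g = K -> hset K `<=` hset H ->
  (H * K)%g = H.
Proof.
move=> HH KK KH; have [_ H1 HM _] := hyperspace_idempotent_subgroup HH.
have [_ K1 _ _] := hyperspace_idempotent_subgroup KK.
apply: hset_inj; rewrite hset_mul eqEsubset; split=> [_ [x Hx [y /KH Hy <-]]|x Hx].
  exact: HM.
by exists x => //; exists 1%g; rewrite // mulg1.
Qed.

(** The unit [L] of [A] is a compact subgroup and equals [H K]; a product of two subgroups that is
    closed under inversion equals the product in the other order. *)
Lemma hyperspace_commute : subgroup_idempotents_commute (hyperspace G).
Proof.
move=> A H K HH KK [AM [L [AL LA Ainv]]] AHK.
have [_ H1 HM HV] := hyperspace_idempotent_subgroup HH.
have [_ K1 KM KV] := hyperspace_idempotent_subgroup KK.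
have LL : (L * L)%g = L by have [] := LA _ AL.
have [_ L1 LM LV] := hyperspace_idempotent_subgroup LL.
have HK1 : hset (H * K)%g 1%g by exists 1%g => //; exists 1%g; rewrite // mulg1.
have [LHK _] := LA _ AHK; have [X [AX HKX _]] := Ainv _ AHK; have [LX _] := LA _ AX.
(* One inclusion holds because [H K] contains 1. For the other, the inverse [X] of [H K] has a point
   [y], which lies in [L], and [x y] in [L] forces [x] into [L]. *)
have HKL : (H * K)%g = L.
  apply: hset_inj; rewrite eqEsubset; split=> x; last first.
    by move=> Lx; rewrite -LHK hset_mul; exists x => //; exists 1%g; rewrite // mulg1.
  move=> HKx; have [[y Xy] _] := hsetP X.
  have Ly : hset L y by rewrite -HKX hset_mul; exists 1%g => //; exists y; rewrite // mul1g.
  have : hset L (x * y)%g by rewrite -HKX hset_mul; exists x => //; exists y.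
  by move=> Lxy; rewrite -(mulgK y x); apply: LM => //; exact: LV.
apply: hset_inj; rewrite [RHS]hset_mul eqEsubset; split=> [x|_ [k Kk [h Hh <-]]].
  rewrite HKL => /LV; rewrite -HKL hset_mul => -[h Hh [k Kk hk]].
  exists k^-1%g; first exact: KV.
  by exists h^-1%g; [exact: HV|rewrite -invgM hk invgK].
have : hset L (h^-1 * k^-1)%g.
  by rewrite -HKL hset_mul; exists h^-1%g; [exact: HV|exists k^-1%g => //; exact: KV].
by rewrite HKL => /LV; rewrite invgM !invgK.
Qed.

End HyperspaceIdempotents.

(** * Separation of compact subgroups by convolution operators *)

Section Separation.
Variables (R : realType) (G : topGroupType).

Lemma urysohn_away (B : set G) (x : G) : closed B -> ~ B x ->
  exists g : G -> R, [/\ continuous g, forall y, 0 <= g y, forall y, B y -> g y = 0 & g x = 1].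
Proof.
move=> clB nBx; have /(@uniform_separatorP _ R)[f [fc f01 fx fB]] := @topgroup_completely_regular G x B clB nBx.
exists (fun y => 1 - f y); split.
- by apply: continuous_subr => //; exact: cst_continuous.
- move=> y; have : `[0, 1]%classic (f y) by apply: f01; exists y.
  by rewrite /= in_itv /= => /andP[_]; rewrite subr_ge0.
- by move=> y By; rewrite (fB (f y)) ?subrr//; exists y.
- by rewrite (fx (f x)) ?subr0//; exists x.
Qed.

(** An approximate identity: [phi] is a bump around 1, normalized to have mean 1 on [M]. *)
Lemma gconv_approx (M : set G) (g : G -> R) (d : R) : compact_subgroup M -> continuous g -> 0 < d ->
  exists2 phi : G -> R, continuous phi &
    forall x, M x -> `|gconv M phi g x - g x| <= d.
Proof.
move=> gM gc d0; have [cM M1 MM MV] := gM.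
have Fc : continuous (fun p : G * G => g p.2) by apply: (continuous_compose gc); cont.
have [|||V V1 gV] := @equicontinuous_family R G G (fun=> g) [set 1%g] M Fc _ cM d.
- exact: compact_set1.
- by [].
- by exists 1%g.
(* Inverses are taken because [y] is [v x] with [v = (x y^-1)^-1]. *)
pose W : set G := [set w | V w^-1%g].
have W1 : nbhs (1%g : G) W.
  have ic : continuous (fun w : G => w^-1%g) by cont.
  by apply: (ic 1%g); rewrite invg1.
have [||psi [psic psi0 psiW psi1]] := @urysohn_away (~` interior W) 1%g.
- by apply: open_closedC; exact: open_interior.
- by apply; exact: nbhs_singleton (nbhs_interior W1).
pose m := mean M psi.
have m0 : 0 < m by apply: (mean_gt0 gM (x0 := 1%g)) => //; rewrite psi1.
have m1 : m^-1 * m = 1 by rewrite mulVf// gt_eqF.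
pose phi x := m^-1 * psi x.
have phic : continuous phi by rewrite /phi; cont.
exists phi => // x Mx.
have pxc := @continuous_phiV R G phi phic x.
have phi1 : mean M (fun y => phi (x * y^-1)%g) = 1.
  have pxc' : continuous (fun y => phi (x * y)%g) by apply: (continuous_compose phic); cont.
  by rewrite (mean_inv gM pxc') (mean_mull gM phic Mx) /phi meanZ.
have -> : g x = mean M (fun y => g x * phi (x * y^-1)%g).
  by rewrite meanZ// phi1 mulr1.
rewrite -[d]mulr1 -phi1 -(meanZ gM)// /gconv.
have bound y : M y -> `|phi (x * y^-1)%g * g y - g x * phi (x * y^-1)%g| <= d * phi (x * y^-1)%g.
  move=> My; rewrite [_ * phi _]mulrC -mulrBr normrM ger0_norm; last first.
    by rewrite mulr_ge0// invr_ge0 ltW.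
  have [Wxy|nWxy] := pselect (interior W (x * y^-1)%g); last first.
    by rewrite /phi psiW// mulr0 !mul0r mulr0.
  rewrite mulrC ler_wpM2r ?mulr_ge0 ?invr_ge0 ?(ltW m0)//.
  have := gV 1%g x (x * y^-1)^-1%g erefl Mx (interior_subset Wxy).
  by rewrite invgM invgK mulgVK.
rewrite -meanB//; [|by cont..].
rewrite ler_norml; apply/andP; split.
  rewrite lerNl -mulN1r -meanZ//; last by cont.
  apply: mean_le => //; [by cont..|] => y /bound.
  by rewrite ler_norml mulN1r => /andP[+ _]; rewrite lerNl.
by apply: mean_le => //; [by cont..|] => y /bound; rewrite ler_norml => /andP[].
Qed.

End Separation.

Section HyperspaceSeparated.
Variables (R : realType) (G : topGroupType).

Lemma normsq_perturb (M : set G) (u v : G -> R) d : compact_subgroup M ->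
  continuous u -> continuous v -> (forall x, M x -> `|u x - v x| <= d) ->
  normsq M u <= 2 * normsq M v + 2 * d ^+ 2.
Proof.
move=> gM uc vc uv.
rewrite /normsq -(mean_cst gM (2 * d ^+ 2)) -meanZ//; last by cont.
rewrite -meanD//; [|by cont..].
apply: mean_le => //; [by cont..|] => x Mx.
have uvx := uv x Mx; have d0 : 0 <= d by exact: le_trans uvx.
have : (u x - v x) ^+ 2 <= d ^+ 2.
  by rewrite -[leLHS]real_normK ?num_real// ler_sqr ?nnegrE.
(* This square is the difference of the two sides of [u^2 <= 2 v^2 + 2 (u - v)^2]. *)
have := sqr_ge0 (2 * v x - u x).
nra.
Qed.

Theorem hyperspace_separated : small_separated (hyperspace G).
Proof.
move=> E cE lE H K0 EH EK0 HK0; have [Ei Ec EM] := lE.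
have hG := @topgroup_hausdorff G.
have gE K : E K -> compact_subgroup (hset K) by move=> /Ei; exact: hyperspace_idempotent_subgroup.
(* The order reverses inclusion, so the least element is the largest subgroup; it contains every
   [hset K], which makes all the projections self-adjoint for the mean over it. *)
have [L0 EL0 L0min] : exists2 L0, E L0 & forall K, E K -> (L0 * K)%g = L0.
  apply: (compact_semilattice_min _ cE lE). 
    exact: hyperspace_hausdorff.
  by exists H.
pose M := hset L0; have gM : compact_subgroup M by exact: gE.
have EsubM K : E K -> hset K `<=` M.
  move=> EK x Kx; rewrite /M -(L0min _ EK) hset_mul; exists 1%g; last by exists x; rewrite // mul1g.
  by have [] := gM.
have gH := gE _ EH.
have [x0 [K0x0 nHx0]] : exists x0, hset K0 x0 /\ ~ hset H x0.
  apply: contrapT => nx; apply: HK0; apply: idempotent_mul_eq; [exact: Ei|exact: Ei|].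
  by move=> x K0x; apply: contrapT => nHx; apply: nx; exists x.
have clH : closed (hset H) by apply: compact_closed => //; have [] := gH.
(* The means of [g] tell the subgroups apart: 0 over [H], and [m > 0] over [N = H K0], which
   contains [x0]. *)
have [g [gc g0 gH0 gx0]] := urysohn_away R clH nHx0.
pose N := (H * K0)%g; have EN : E N by exact: EM.
have gN := gE _ EN.
have Nx0 : hset N x0 by have [_ H1 _ _] := gH; exists 1%g => //; exists x0; rewrite // mul1g.
pose m := mean (hset N) g.
have m0 : 0 < m by apply: (mean_gt0 gN gc _ Nx0) => //; rewrite gx0.
(* With error [m / 3], the values at 1 of the two projections of the convolution, near 0 and near
   [m], remain distinct. *)
have [phi phic phig] := gconv_approx gM gc (divr_gt0 m0 (ltr0n _ 3)).
pose T f := invproj (hset H) (gconv M phi f).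
have cvc f : continuous f -> continuous (gconv M phi f) by exact: continuous_gconv.
have Tc f : continuous f -> continuous (T f).
  by move=> fc; apply: continuous_invproj => //; exact: cvc.
have TB f f' : continuous f -> continuous f' -> T (fun x => f x - f' x) = (fun x => T f x - T f' x).
  by move=> fc f'c; rewrite /T gconvB// invprojB//; exact: cvc.
have projM K L f : E K -> E L -> continuous f ->
    invproj (hset K) (invproj (hset L) f) = invproj (hset (K * L)%g) f.
  by move=> EK EL fc; rewrite invproj_comp//; [exact: gE|exact: gE|exact: (gE _ (EM _ _ EK EL))].
have projT K f : E K -> continuous f -> invproj (hset K) (T f) = T (invproj (hset K) f).
  move=> EK fc; rewrite /T projM//; last exact: cvc.
  rewrite (Ec _ _ EK EH) -projM//; last exact: cvc.
  by rewrite invproj_gconv//; [exact: gE|exact: EsubM].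
have TKE K f : E K -> continuous f -> (fun x => T f x - invproj (hset K) (T f) x) =
    (fun x => invproj (hset H) (gconv M phi f) x - invproj (hset (K * H)%g) (gconv M phi f) x).
  by move=> EK fc; rewrite /T projM//; exact: cvc.
pose D K x := T g x - invproj (hset K) (T g) x.
have Dc K : E K -> continuous (D K).
  move=> EK; have Tgc := Tc _ gc; have := continuous_invproj (gE _ EK) Tgc.
  by rewrite /D => ?; cont.
pose q := normsq M (D K0).
have M1 : M 1%g by have [] := gM.
have q0 : 0 < q.
  have D1 : D K0 1%g != 0.
    have := TKE K0 g EK0 gc => /(congr1 (@^~ 1%g)); rewrite -/(D K0 1%g) => ->.
    rewrite (Ec _ _ EK0 EH) -/N.
    have close K : E K -> `|invproj (hset K) (gconv M phi g) 1%g - mean (hset K) g| <= m / 3.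
      move=> EK; have gK := gE _ EK; apply: (mean_dist gK) => //.
        by apply: continuous_translate; exact: cvc.
      by move=> x /(EsubM _ EK) Mx; rewrite mul1g; exact: phig.
    have := close _ EH; have := close _ EN; rewrite -/m.
    have -> : mean (hset H) g = 0.
      rewrite -[RHS](mean_cst gH); apply: eq_mean => //; first exact: cst_continuous.
    rewrite subr0 !ler_norml => /andP[? ?] /andP[? ?]; apply/eqP; lra.
  apply: (mean_gt0 gM (x0 := 1%g)) => //.
  - by have DK0c := Dc _ EK0; cont.
  - by move=> x _; rewrite -expr2 sqr_ge0.
  - by rewrite -expr2 lt0r sqr_ge0 expf_neq0.
pose n := normsq M g; have n0 : 0 <= n by exact: normsq_ge0.
(* The numbers [e] and later [d] make [2 e^2 n] and [2 d^2] at most [q / 4] each, so that together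
   they stay below [q]; [n + 1] keeps the denominator positive. *)
pose e := Num.sqrt (q / (8 * (n + 1))).
have n1 : 0 < 8 * (n + 1) by rewrite mulr_gt0// ltr_wpDl.
have e2 : e ^+ 2 = q / (8 * (n + 1)) by rewrite sqr_sqrtr// divr_ge0// ltW.
have e0 : 0 < e by rewrite sqrtr_gt0 divr_gt0.
pose V := [set K | E K /\ nearly_fixed M T (hset K) (e ^+ 2)].
have VM : subsemigroup V.
  move=> K L [EK VK] [EL VL]; split; first exact: EM.
  rewrite hset_mul; apply: nearly_fixed_prod => //; [exact: gE|exact: gE|..].
  - exact: (gE _ (EM _ _ EK EL)).
  - by rewrite -[LHS]/(hset (K * L)%g) -[RHS]/(hset (L * K)%g) Ec.
  - exact: EsubM.
  - by move=> f fc; exact: projT.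
have cM : compact M by have [] := gM.
have VH : exists2 U, nbhs H U & E `&` U `<=` V.
  have Fc : continuous (fun p : (G * G) * G => phi (p.1.1 * p.2 * p.1.2^-1)%g).
    by apply: (continuous_compose phic); cont.
  have nearH := @mean_hyperspace_continuous R G (G * G)%type
    (fun p k => phi (p.1 * k * p.2^-1)%g) (M `*` M) H e Fc (compact_setX cM cM) gH e0.
  have mulH : continuous (fun K : hyperspace G => (K * H)%g) by cont.
  pose near_averages := [set K : hyperspace G | compact_subgroup (hset K) ->
    forall p, (M `*` M) p -> `|mean (hset H) (fun k => phi (p.1 * k * p.2^-1)%g) -
      mean (hset K) (fun k => phi (p.1 * k * p.2^-1)%g)| <= e].
  have nearHH : nbhs (H * H)%g near_averages by rewrite (Ei _ EH).
  exists [set K | near_averages (K * H)%g]; first exact: (mulH H _ nearHH).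
  move=> K [EK /= nearK]; split=> // f fc; rewrite TKE//.
  have gKH := gE _ (EM _ _ EK EH).
  apply: normsq_kernel_le => //; first exact: ltW.
  by move=> x y Mx My; exact: (nearK gKH (x, y)).
have [U UH EUV] := VH.
(* Were [K0] in the closure, a member [K] of [V] near [K0] would have [D K] close to [D K0], and the
   bound on [D K] would make [q] too small. *)
exists (closure V), U; split.
- exact: closed_closure.
- exact: UH.
- by move=> K /EUV VK; exact: subset_closure.
- by move=> K L [EK VK] [EL VL]; split; [exact: EM|exact: closure_subsemigroup].
move=> clV.
have Fc : continuous (fun p : G * G => T g (p.1 * p.2)%g) by exact: (continuous_translate2 (Tc _ gc)).
pose d := Num.sqrt (q / 8).
have d2 : d ^+ 2 = q / 8 by rewrite sqr_sqrtr// divr_ge0// ltW.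
have d0 : 0 < d by rewrite sqrtr_gt0 divr_gt0.
have nearK0 := @mean_hyperspace_continuous R G G (fun x k => T g (x * k)%g) M K0 d Fc cM (gE _ EK0) d0.
have [K [[EK VK] /= KK0]] := clV _ nearK0.
have DK : normsq M (D K) <= e ^+ 2 * n by exact: VK.
have : q <= 2 * normsq M (D K) + 2 * d ^+ 2.
  apply: normsq_perturb => //; [exact: Dc|exact: Dc|] => x Mx.
  rewrite (_ : _ - _ = - (invproj (hset K0) (T g) x - invproj (hset K) (T g) x)).
    by rewrite normrN; exact: (KK0 (gE _ EK)).
  by rewrite /D; ring.
rewrite d2 => qD; move: DK; rewrite e2 => DK.
have : q / (8 * (n + 1)) * n <= q / 8.
  rewrite invfM mulrA -mulrA ler_piMr ?divr_ge0 ?(ltW q0)//.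
  by rewrite ler_pdivrMl ?ltr_wpDl// mulr1 lerDl.
lra.
Qed.

End HyperspaceSeparated.

(** * Continuous semilattices *)

Section ContinuousSemilattices.
Local Open Scope group_scope.

Section WayBelow.
Variables (S : topSemigroupType) (E : set S).
Hypotheses (hS : hausdorff_space S) (cE : compact E) (lE : subsemilattice E).
Implicit Types (x y z w : S).

(* In a compact semilattice this is the way-below relation of domain theory. *)
Definition way_below z y : Prop := E z /\ nbhs y [set x | E x -> z * x = z].

Definition continuous_semilattice : Prop := forall y w, E y -> E w -> y * w <> y ->
  exists2 z, way_below z y & z * w <> z.

Lemma way_below_le z y : E y -> way_below z y -> z * y = z.
Proof. by move=> Ey [_ /nbhs_singleton]; apply. Qed.

Lemma nbhs_mul_neq z t : z * t <> z -> nbhs t [set x | z * x <> z].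
Proof.
move=> zt; have cz : continuous (fun x => z * x) by cont.
have ck : continuous (fun _ : S => z) by cont.
exact: (nbhs_neq hS cz ck zt).
Qed.

Lemma mul_le_mul z x y : E z -> E x -> E y -> z * (x * y) = z -> z * x = z.
Proof.
move=> Ez Ex Ey; have [Ei Ec _] := lE => zxy.
by rewrite -[in LHS]zxy (Ec _ _ Ex Ey) -!mulgA Ei// -(Ec _ _ Ex Ey).
Qed.

Hypothesis ctsE : continuous_semilattice.

(** Finitely many [z] way below [y] exclude every [t] below [y] outside [U]. Their least upper bound
    [w], found as the minimum of the compact semilattice of their upper bounds, is again way below
    [y], so it lies in [U]. *)
Lemma way_below_nbhs y U : E y -> nbhs y U -> exists2 w, way_below w y & U w.
Proof.
move=> Ey yU; have [Ei Ec EM] := lE.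
pose C := E `&` [set t | t * y = t] `&` ~` interior U.
have cC : compact C.
  apply: compact_closedI; last by apply: open_closedC; exact: open_interior.
  apply: compact_closedI => //; apply: closed_eq_fun => //; first by cont.
  by move=> x; exact: cvg_id.
have [t [[Et ty] Ut]|s sP sN] := compact_finite_nbhs_cover
    (P := [set z | way_below z y]) (N := fun z => [set x | z * x <> z]) cC.
  have [yt|z zy zt] := ctsE Ey Et; last by exists z => //; exact: nbhs_mul_neq.
  by apply: Ut; rewrite -ty (Ec _ _ Et Ey) yt; exact: nbhs_singleton (nbhs_interior yU).
pose V := E `&` [set x | forall z, z \in s -> z * x = z].
have Vy : V y by split=> // z /sP; exact: (way_below_le Ey).
have cV : compact V.
  apply: compact_closedI => // x clx z zs.
  have cz : continuous (fun x => z * x) by cont.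
  apply: contrapT => zx; have [x' [/= /(_ z zs) zx' zx'N]] := clx _ (nbhs_mul_neq zx).
  exact: zx'N.
have lV : subsemilattice V.
  split; [by move=> x [/Ei]|by move=> x x' [Ex _] [Ex' _]; exact: Ec|].
  move=> x x' [Ex sx] [Ex' sx']; split; first exact: EM.
  by move=> z zs; rewrite mulgA sx// sx'.
have [w [Ew sw] wV] := compact_semilattice_min hS cV lV (ex_intro _ y Vy).
have wy : way_below w y.
  split=> //; have : nbhs y [set x | forall z, z \in s -> E x -> z * x = z].
    by apply: filter_forall_seq => z /sP[].
  by apply: filterS => x sx Ex; apply: wV; split=> // z zs; exact: sx.
exists w => //; apply: contrapT => Uw.
have [|z zs] := sN w; last by rewrite /= sw.
by split; [split=> //; exact: (way_below_le Ey wy)|move=> /interior_subset].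
Qed.

Lemma way_below_interpolate z y : E y -> way_below z y ->
  exists2 w, way_below z w & way_below w y.
Proof.
move=> Ey [Ez /nbhs_interior zy].
by have [w wy zw] := way_below_nbhs Ey zy; exists w.
Qed.

Definition relatively_open (A : set S) : Prop :=
  forall x, A x -> nbhs x [set x' | E x' -> A x'].

(** Interpolation gives a sequence descending from [y], each term way below the previous one and all
    terms above [z]; the up-sets of its terms increase to an open filter. *)
Lemma open_filter z y : E y -> way_below z y ->
  exists A, [/\ A `<=` E, A y, subsemigroup A, relatively_open A & forall x, A x -> z * x = z].
Proof.
move=> Ey zy; have [Ei Ec EM] := lE.
have /choice[g gP] : forall w, exists w', E w -> way_below z w -> way_below z w' /\ way_below w' w.
  move=> w; have [[Ew zw]|nw] := pselect (E w /\ way_below z w).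
    by have [w' ? ?] := way_below_interpolate Ew zw; exists w'.
  by exists w => Ew zw; case: nw.
pose w n := iter n g y.
have wP n : E (w n) /\ way_below z (w n).
  by elim: n => [|n [Ew zw]] //=; have [zw' [Ew' _]] := gP _ Ew zw.
have ww n : way_below (w n.+1) (w n) by have [Ew zw] := wP n; have [] := gP _ Ew zw.
have wS n x : w n * x = w n -> w n.+1 * x = w n.+1.
  have [Ew _] := wP n; have wle := way_below_le Ew (ww n).
  by move=> wx; rewrite -[in LHS]wle -mulgA wx.
have wD n k x : w n * x = w n -> w (n + k)%N * x = w (n + k)%N.
  by elim: k => [|k IH] wx; rewrite ?addn0// addnS; exact/wS/IH.
exists [set x | E x /\ exists n, w n * x = w n]; split.
- by move=> x [].
- by split=> //; exists 0%N; exact: Ei.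
- move=> x x' [Ex [n wx]] [Ex' [n' wx']]; split; first exact: EM.
  by exists (n + n')%N; rewrite mulgA wD// addnC wD.
- move=> x [Ex [n wx]]; have [Ew _] := wP n; have wle := way_below_le Ew (ww n).
  have [_ wwn] := ww n; have cw : continuous (fun x => w n * x) by cont.
  have nwx : nbhs (w n * x) [set x | E x -> w n.+1 * x = w n.+1] by rewrite wx.
  have : nbhs x [set x' | E (w n * x') -> w n.+1 * (w n * x') = w n.+1].
    exact: (cw x _ nwx).
  apply: filterS => x' /= wx' Ex'; split=> //; exists n.+1.
  by rewrite -[in LHS]wle -mulgA wx'//; exact: EM.
- move=> x [Ex [n wx]]; have [Ew zw] := wP n.
  by have zwn := way_below_le Ew zw; rewrite -[in LHS]zwn -mulgA wx.
Qed.

(** If [p] is below [y], an open filter around [y] is taken whose members lie above some [z] that is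
    not below [p]. Otherwise some [c] way below [p] is not below [y], and the elements not above [c]
    are closed under products, as whatever lies below a product lies below its factors. *)
Lemma separating_subsemilattice y p : E y -> E p -> p <> y ->
  exists A, [/\ A `<=` E, A y, subsemigroup A, relatively_open A &
    nbhs p [set x | E x -> ~ A x]].
Proof.
move=> Ey Ep py; have [Ei Ec EM] := lE.
have [pyp|pyp] := pselect (p * y = p).
  have [|z zy zp] := ctsE Ey Ep; first by rewrite -(Ec _ _ Ep Ey) pyp.
  have [A [AE Ay AM Ao zA]] := open_filter Ey zy.
  exists A; split=> //; apply: filterS (nbhs_mul_neq zp) => x zx _ /zA; exact: zx.
have [c [Ec' cp] cy] := ctsE Ep Ey pyp.
exists [set x | E x /\ c * x <> c]; split.
- by move=> x [].
- by [].
- move=> x x' [Ex cx] [Ex' cx']; split; first exact: EM.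
  by move=> cxx'; apply: cx; exact: (mul_le_mul Ec' Ex Ex' cxx').
- by move=> x [Ex cx]; apply: filterS (nbhs_mul_neq cx).
- by apply: filterS cp => x /= cx Ex [_]; apply; exact: cx.
Qed.

Lemma subsemilattice_base y U : E y -> nbhs y U ->
  exists A, [/\ A `<=` E `&` U, A y, subsemigroup A & relatively_open A].
Proof.
move=> Ey yU; have [Ei Ec EM] := lE.
have /choice[B BP] : forall p, exists A, E p -> p <> y -> [/\ A `<=` E, A y, subsemigroup A,
    relatively_open A & nbhs p [set x | E x -> ~ A x]].
  move=> p; have [[Ep py]|np] := pselect (E p /\ p <> y).
    by have [A ?] := separating_subsemilattice Ey Ep py; exists A.
  by exists setT => Ep py; case: np.
pose C := E `&` ~` interior U.
have cC : compact C.
  by apply: compact_closedI => //; apply: open_closedC; exact: open_interior.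
have [p [Ep Up]|s sC sN] := compact_finite_nbhs_cover (P := C)
    (N := fun p => [set x | E x -> ~ B p x]) cC.
  exists p => //; have [] // := BP p Ep _ => py.
  by apply: Up; rewrite py; exact: nbhs_singleton (nbhs_interior yU).
have {}BP p : p \in s -> [/\ B p `<=` E, B p y, subsemigroup (B p),
    relatively_open (B p) & nbhs p [set x | E x -> ~ B p x]].
  move=> /sC[Ep Up]; apply: BP => // py.
  by apply: Up; rewrite py; exact: nbhs_singleton (nbhs_interior yU).
exists (E `&` [set x | forall p, p \in s -> B p x]); split.
- move=> x [Ex sx]; split=> //; apply: interior_subset; apply: contrapT => Ux.
  by have [|p ps] := sN x; [|apply=> //; exact: sx].
- by split=> // p /BP[].
- move=> x x' [Ex sx] [Ex' sx']; split; first exact: EM.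
  by move=> p ps; have [_ _ BM _ _] := BP p ps; apply: BM; [exact: sx|exact: sx'].
- move=> x [Ex sx].
  have : nbhs x [set x' | forall p, p \in s -> E x' -> B p x'].
    apply: filter_forall_seq => p ps; have [_ _ _ Bo _] := BP p ps.
    exact/Bo/sx.
  by apply: filterS => x' sx' Ex'; split=> // p ps; exact: sx'.
Qed.

Lemma continuous_semilattice_lawson : lawson E.
Proof.
split=> [U []//|x U]; rewrite nbhsE => -[D [oD Dx] DU].
have [V oV VD] := oD; have Ex : E (set_val x) by exact: set_valP.
have Vx : V (set_val x) by rewrite -[V _]/((set_val @^-1` V) x) VD.
have [A [AEV Ax AM Ao]] := subsemilattice_base Ex (open_nbhs_nbhs (conj oV Vx)).
pose W := interior [set x' | E x' -> A x'].
have WA (u : E) : W (set_val u) <-> A (set_val u).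
  split=> [/interior_subset|Au]; first by apply; exact: set_valP.
  by apply: nbhs_singleton; apply: nbhs_interior; exact: Ao.
exists (set_val @^-1` W).
  split; last by apply/WA.
  split; first by exists W => //; exact: open_interior.
  move=> _ _ [u /WA Au <-] [v /WA Av <-].
  have Auv := AM _ _ Au Av; have [Euv _] := AEV _ Auv.
  by exists (SigSub (mem_set Euv) : E) => //; apply/WA.
by move=> u /WA Au; apply: DU; rewrite -VD; have [] := AEV _ Au.
Qed.

End WayBelow.

(** Let [m] be the least element of the fibre over [y]. Finitely many closed subsemilattices around
    [m] avoid all [t] below [m] whose image is below [w]; the minimum [z] of their intersection has
    its image way below [y] but not below [w]. *)
Lemma continuous_semilattice_image (S0 S : topSemigroupType) (f : S0 -> S) (E0 : set S0) :
  hausdorff_space S0 -> hausdorff_space S -> compact E0 -> subsemilattice E0 ->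
  small_separated S0 -> continuous f -> (forall x y, f (x * y) = f x * f y) ->
  continuous_semilattice (f @` E0).
Proof.
move=> hS0 hS cE0 lE0 sepS0 fc fM y w [t0 Et0 ft0] [t1 Et1 ft1] yw.
have [Ei Ec EM] := lE0.
have clf u : closed [set t | f t = u].
  by apply: closed_eq_fun => //; exact: cst_continuous.
pose Q := E0 `&` [set t | f t = y].
have [m [Em fm] Qm] : exists2 m, Q m & forall t, Q t -> m * t = m.
  have yy : y * y = y by rewrite -ft0 -fM Ei.
  apply: compact_semilattice_min => //; last by exists t0.
    by apply: compact_closedI => //; exact: clf.
  split; [by move=> t [/Ei]|by move=> t u [Et _] [Eu _]; exact: Ec|].
  by move=> t u [Et /= ft] [Eu /= fu]; split; [exact: EM|rewrite /= fM ft fu].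
pose C := E0 `&` [set t | t * m = t] `&` [set t | f t * w = f t].
have cC : compact C.
  apply: compact_closedI; first apply: compact_closedI => //.
    by apply: closed_eq_fun => //; cont.
  apply: closed_eq_fun => //.
  have cw : continuous (fun x : S => x * w) by cont.
  exact: (continuous_compose cw fc).
have /choice[K KP] : forall t, exists K : set S0 * set S0, C t -> [/\ closed K.1, nbhs m K.2,
    E0 `&` K.2 `<=` K.1, subsemigroup (E0 `&` K.1) & ~ K.1 t].
  move=> t; have [[[Et tm] ftw]|nC] := pselect (C t); last by exists (setT, setT).
  have [|A [N ?]] := sepS0 E0 cE0 lE0 m t Em Et; last by exists (A, N).
  move=> mt; apply: yw; have tE : t = m by rewrite -[LHS]tm (Ec _ _ Et Em).
  by rewrite -fm -tE.
have [t Ct|s sC sN] := compact_finite_nbhs_cover (P := C) (N := fun t => ~` (K t).1) cC.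
  exists t => //; have [Kc _ _ _ Kt] := KP t Ct.
  by apply: open_nbhs_nbhs; split=> //; exact: closed_openC.
have {}KP t : t \in s -> [/\ closed (K t).1, nbhs m (K t).2,
    E0 `&` (K t).2 `<=` (K t).1 & subsemigroup (E0 `&` (K t).1)].
  by move=> /sC/KP[].
pose V := E0 `&` [set x | forall t, t \in s -> (K t).1 x].
have lV : subsemilattice V.
  split; [by move=> x [/Ei]|by move=> x x' [Ex _] [Ex' _]; exact: Ec|].
  move=> x x' [Ex sx] [Ex' sx']; split; first exact: EM.
  move=> t ts; have [_ _ _ KM] := KP t ts.
  by have [] := KM x x' (conj Ex (sx t ts)) (conj Ex' (sx' t ts)).
have cV : compact V.
  apply: compact_closedI => // x clx t ts; have [Kc _ _ _] := KP t ts.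
  by apply: Kc => N xN; have [x' [sx' Nx']] := clx N xN; exists x'; split=> //; exact: sx'.
have nearV : nbhs m [set x | E0 x -> V x].
  have : nbhs m [set x | forall t, t \in s -> (K t).2 x].
    by apply: filter_forall_seq => t ts; have [] := KP t ts.
  apply: filterS => x sx Ex; split=> // t ts; have [_ _ EK _] := KP t ts.
  by apply: EK; split=> //; exact: sx.
have Vm : V m by exact: (nbhs_singleton nearV Em).
have [z [Ez sz] zV] := compact_semilattice_min hS0 cV lV (ex_intro _ m Vm).
have fzw : f z * w <> f z.
  move=> fzw; have [|t ts Kz] := sN z; last exact: (Kz (sz t ts)).
  by split=> //; split=> //; exact: zV.
exists (f z) => //; split; first by exists z.
(* As [m] is least in the fibre, multiplication by [m] carries points near any [t] of the fibre to
   points near [m], so [z] is below them. *)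
have nearQ t : E0 t -> f t = y -> nbhs t [set t' | E0 t' -> z * t' = z].
  move=> Et ft; have mt : m * t = m by exact: Qm.
  have cm : continuous (fun t' => m * t') by cont.
  have nV : nbhs (m * t) [set x | E0 x -> V x] by rewrite mt.
  have : nbhs t [set t' | E0 (m * t') -> V (m * t')] by exact: (cm t _ nV).
  apply: filterS => t' mt' Et'; apply: (mul_le_mul lE0 Ez Et' Em).
  by rewrite (Ec _ _ Et' Em); apply: zV; apply: mt'; exact: EM.
have /compact_near_coveringP ncE0 := cE0.
(* Compactness of [E0] keeps the preimages of points near [y] close to the fibre over [y]. *)
have : \forall y' \near nbhs y, E0 `<=` [set t | E0 t -> f t = y' -> z * t = z].
  apply: ncE0 => t Et; have [ft|ft] := pselect (f t = y).
    exists ([set t' | E0 t' -> z * t' = z], setT) => /=.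
      by split; [exact: nearQ|exact: filterT].
    by move=> [t' y'] /= [zt' _] Et' _; exact: zt'.
  have [A [B [ftA yB AB]]] := hausdorff_disjoint_nbhs hS ft.
  exists (f @^-1` A, B) => /=; first by split=> //; exact: fc.
  by move=> [t' y'] /= [At' By'] _ fty; case: (AB (f t')) => //; rewrite fty.
apply: filterS => y' Ey' /= [t Et fty]; have zt := Ey' t Et Et fty.
by rewrite -fty -fM zt.
Qed.

End ContinuousSemilattices.

(** * Images of compact Clifford semigroups in [class_H0] *)

Section Forward.
Local Open Scope group_scope.

Lemma class_H0_properties (R : realType) (S : topSemigroupType) : class_H0 S ->
  [/\ hausdorff_space S, small_separated S & subgroup_idempotents_commute S].
Proof.
elim=> [I S' T _ IH TS|G T sigma _ _ [hT sT cT]|T _ [G TG]].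
- split.
  + have [f _ fe] := TS; apply: (embedding_hausdorff fe).
    by apply: prod_hausdorff => i; have [] := IH i.
  + by apply: (embedding_separated TS) => i; have [] := IH i.
  + by apply: (embedding_commute TS) => i; have [] := IH i.
- split; [exact: semidirect_hausdorff|exact: semidirect_separated|exact: semidirect_commute].
- split.
  + have [f _ fe] := TG; apply: attach_zero_hausdorff.
    by apply: (embedding_hausdorff fe); exact: hyperspace_hausdorff.
  + apply: attach_zero_separated; apply: (embedding_separated1 TG).
    exact: (hyperspace_separated R).
  + by apply: attach_zero_commute; apply: (embedding_commute1 TG); exact: hyperspace_commute.
Qed.

Lemma inverse_of_unique (S : topSemigroupType) (x y z : S) :
  (forall e f : S, e * e = e -> f * f = f -> e * f = f * e) ->
  inverse_of x y -> inverse_of x z -> y = z.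
Proof.
move=> comm [xyx yxy] [xzx zxz].
have xyI : (x * y) * (x * y) = x * y by rewrite mulgA xyx.
have yxI : (y * x) * (y * x) = y * x by rewrite mulgA yxy.
have xzI : (x * z) * (x * z) = x * z by rewrite mulgA xzx.
have zxI : (z * x) * (z * x) = z * x by rewrite mulgA zxz.
have y_eq : y = y * ((x * z) * (x * y)).
  have -> : y * ((x * z) * (x * y)) = y * (x * z * x) * y by rewrite !mulgA.
  by rewrite xzx yxy.
have z_eq : z = ((z * x) * (y * x)) * z.
  have -> : ((z * x) * (y * x)) * z = z * (x * y * x) * z by rewrite !mulgA.
  by rewrite xyx zxz.
rewrite y_eq (comm _ _ xzI xyI) [RHS]z_eq (comm _ _ zxI yxI).
have -> : y * (x * y * (x * z)) = (y * x * y) * x * z by rewrite !mulgA.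
have -> : y * x * (z * x) * z = y * x * (z * x * z) by rewrite !mulgA.
by rewrite yxy zxz.
Qed.

Lemma subgroup_inverse (S : topSemigroupType) (A : set S) x : subgroup A -> A x ->
  exists e y, [/\ inverse_of x y, e * e = e, x * y = e, y * x = e & e * x = x /\ x * e = x].
Proof.
move=> [AM [e [Ae eA Ainv]]] Ax; have [y [Ay xy yx]] := Ainv _ Ax.
have [ex xe] := eA _ Ax; have [ey ye] := eA _ Ay; have [ee _] := eA _ Ae.
by exists e, y; split=> //; split; rewrite ?xy ?yx.
Qed.

(** The points over [x] outside [V] form a compact set that misses the graph, so a whole tube around
    them misses it. *)
Lemma closed_graph_continuous (X Y : topologicalType) (f : X -> Y) :
  compact [set: Y] -> closed [set p : X * Y | p.2 = f p.1] -> continuous f.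
Proof.
move=> cY clf x U; rewrite nbhsE => -[V [oV Vfx] VU].
suff : nbhs x [set x' | V (f x')] by apply: filterS => x' /VU.
have [nV0|/set0P nV0] := eqVneq (~` V) set0.
  apply: filterE => x'; apply: contrapT => nVx'.
  by have : (~` V) (f x') by []; rewrite nV0.
have cV : compact (~` V).
  by apply: (subclosed_compact _ cY) => //; exact: open_closedC.
have [|_ y -> nVy|A [B [xA VB AB]]] := compact_prod_nbhs (K := [set x])
    (O := ~` [set p : X * Y | p.2 = f p.1]) _ cV nV0.
- exact: compact_set1.
- apply: open_nbhs_nbhs; split; first exact: closed_openC.
  by move=> /= yfx; apply: nVy; rewrite yfx.
have {}xA : nbhs x A by exact: xA.
apply: filterS xA => x' Ax'; apply: contrapT => nVx'.
apply: (AB (x', f x')) => //; split=> //=.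
by apply: nbhs_singleton; exact: VB.
Qed.

Lemma inverse_of_closed (S : topSemigroupType) : hausdorff_space S ->
  closed [set p : S * S | inverse_of p.1 p.2].
Proof.
move=> hS.
have c1 : continuous (fun p : S * S => p.1 * p.2 * p.1) by cont.
have c2 : continuous (fun p : S * S => p.2 * p.1 * p.2) by cont.
rewrite (_ : [set p : S * S | _] = [set p | p.1 * p.2 * p.1 = p.1] `&` [set p | p.2 * p.1 * p.2 = p.2]).
  apply: closedI; apply: closed_eq_fun => //.
    exact: continuous_fst_proj.
  exact: continuous_snd_proj.
by rewrite eqEsubset; split=> p [].
Qed.

(** The equations of an inverse cut out a closed graph, and compactness of [S] makes inversion
    continuous. *)
Lemma clifford_topological_inverse (S : topSemigroupType) :
  hausdorff_space S -> compact [set: S] -> clifford S ->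
  (forall e f : S, e * e = e -> f * f = f -> e * f = f * e) -> topological_inverse S.
Proof.
move=> hS cS clS comm.
have invS (x : S) : exists y, inverse_of x y.
  by have [A gA Ax] := clS x; have [_ [y [? _ _ _ _]]] := subgroup_inverse gA Ax; exists y.
split.
  by move=> x; have [y xy] := invS x; exists y; split=> // z; exact: inverse_of_unique.
have /choice[inv invP] := invS.
exists inv => //; apply: closed_graph_continuous => //.
rewrite (_ : [set _ | _] = [set p : S * S | inverse_of p.1 p.2]); first exact: inverse_of_closed.
rewrite eqEsubset; split=> [p /= ->|p pP]; first exact: invP.
exact: (inverse_of_unique comm pP (invP _)).
Qed.

Lemma idempotents_compact (S : topSemigroupType) :
  hausdorff_space S -> compact [set: S] -> compact (idempotents S).
Proof.
move=> hS cS; apply: (subclosed_compact _ cS) => //.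
by apply: closed_eq_fun => //; cont.
Qed.

Lemma idempotents_subsemilattice (S : topSemigroupType) :
  (forall e f : S, e * e = e -> f * f = f -> e * f = f * e) ->
  subsemilattice (idempotents S).
Proof.
move=> comm; split; [by []|by move=> e f; exact: comm|].
move=> e f Ee Ef; rewrite /idempotents /= -mulgA (mulgA f) (comm _ _ Ef Ee).
by rewrite -mulgA Ef mulgA Ee.
Qed.

Lemma compact_clifford_image (R : realType) (S0 S : topSemigroupType) :
  hausdorff_space S -> compact [set: S0] -> clifford S0 -> class_H0 S0 ->
  continuous_hom_image S0 S ->
  [/\ compact [set: S], clifford S, topological_inverse S & lawson (idempotents S)].
Proof.
move=> hS cS0 clS0 H0 [f [fM fc fS]].
have [hS0 sS0 comm0] := class_H0_properties R H0.
have surj (y : S) : exists x, f x = y.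
  by have : [set: S] y by []; rewrite -fS => -[x _ <-]; exists x.
have comm00 (e g : S0) : e * e = e -> g * g = g -> e * g = g * e.
  by move=> ee gg; have [A gA Aeg] := clS0 (e * g); exact: (comm0 A).
have cS : compact [set: S].
  by rewrite -fS; apply: continuous_compact => //; exact: continuous_subspaceT.
have clS : clifford S.
  move=> y; have [x <-] := surj y; have [A gA Ax] := clS0 x.
  by exists (f @` A); [exact: subgroup_image|exists x].
(* An idempotent [y = f x] is the image of the unit [u] of a subgroup through [x]: as [f u] is
   [y * f x'], the product [y * f u] equals both [y] and [f u]. *)
have fE : f @` idempotents S0 = idempotents S.
  rewrite eqEsubset; split=> [_ [e ee <-]|y yy]; first by rewrite /idempotents /= -fM ee.
  have [x fx] := surj y; have [A gA Ax] := clS0 x.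
  have [u [x' [_ uu xx' _ [_ xu]]]] := subgroup_inverse gA Ax.
  exists u => //; have yfu : y * f u = y by rewrite -fx -fM xu.
  by rewrite -yfu -xx' fM fx mulgA yy.
have comm (e g : S) : e * e = e -> g * g = g -> e * g = g * e.
  move=> ee gg; have : idempotents S e by []; have : idempotents S g by [].
  by rewrite -fE => -[u uu <-] [v vv <-]; rewrite -!fM comm00.
split=> //; first exact: clifford_topological_inverse.
apply: continuous_semilattice_lawson => //.
- exact: idempotents_compact.
- exact: idempotents_subsemilattice.
rewrite -fE; apply: continuous_semilattice_image => //.
- exact: idempotents_compact.
- exact: idempotents_subsemilattice.
Qed.

End Forward.

(** * Maximal subgroups of a compact Clifford inverse semigroup *)

Section Subsemigroups.
Local Open Scope group_scope.

Lemma compact_set_type (X : topologicalType) (A : set X) :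
  compact A -> compact [set: set_type A].
Proof.
move=> /compact_near_coveringP cA; apply/compact_near_coveringP => I F P FF PF.
have : \forall i \near F, A `<=` [set x | forall u : A, set_val u = x -> P i u].
  apply: cA => x Ax; pose u : A := SigSub (mem_set Ax).
  have [[N B] /= [uN FB] NBP] := PF u Logic.I.
  move: uN; rewrite nbhsE => -[D [[V oV VD] Du] DN].
  have Vx : V x by rewrite -[V x]/((set_val @^-1` V) u) VD.
  exists (V, B); first by split=> //; exact: open_nbhs_nbhs.
  move=> [x' i] /= [Vx' Bi] v vx'; apply: (NBP (v, i)); split=> //; apply: DN.
  by rewrite -VD /= vx'.
by apply: filterS => i AP u _; apply: (AP (set_val u)) => //; exact: set_valP.
Qed.

Lemma set_val_embedding (X : topologicalType) (A : set X) :
  topological_embedding (set_val : A -> X).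
Proof.
split; first exact: val_inj.
by move=> U; split=> [[V oV <-]|[V oV ->]]; [exists V|exists V].
Qed.

Lemma continuous_set_type (X Y : topologicalType) (A : set Y) (f : X -> A) :
  continuous (fun x => set_val (f x)) -> continuous f.
Proof.
move=> fc x U; rewrite nbhsE => -[D [[V oV VD] Df] DU].
have Vf : nbhs (set_val (f x)) V.
  by apply: open_nbhs_nbhs; split=> //; rewrite -[V _]/((set_val @^-1` V) (f x)) VD.
have : nbhs x [set y | V (set_val (f y))] by exact: (fc x _ Vf).
by apply: filterS => y Vy; apply: DU; rewrite -VD.
Qed.

Variables (S : topSemigroupType) (A : set S) (AM : subsemigroup A).

(** The [let] keeps the closure proof [AM] as an argument of the type, so that the instances below
    can use it for the multiplication. *)
Definition subsemigroup_type : Type := let _ := AM in set_type A.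
Local Notation T := subsemigroup_type.

HB.instance Definition _ := Topological.copy T (set_type A).

Definition sub_val (x : T) : S := set_val (x : set_type A).

Lemma sub_valP x : A (sub_val x).
Proof. exact: set_valP. Qed.

Definition subsemigroup_mul (x y : T) : T :=
  (SigSub (mem_set (AM (sub_valP x) (sub_valP y))) : set_type A).

Lemma sub_val_inj : injective sub_val.
Proof. exact: val_inj. Qed.

Lemma subsemigroup_mulA : associative subsemigroup_mul.
Proof. by move=> x y z; apply: sub_val_inj; exact: mulgA. Qed.

HB.instance Definition _ := isSemigroup.Build T subsemigroup_mulA.

Lemma sub_val_topological_embedding : topological_embedding sub_val.
Proof. exact: set_val_embedding. Qed.

Lemma sub_val_continuous : continuous sub_val.
Proof. exact: embedding_continuous sub_val_topological_embedding. Qed.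

Lemma subsemigroup_mul_continuous : continuous (fun p : T * T => p.1 * p.2).
Proof.
apply: continuous_set_type.
have c1 : continuous (fun p : T * T => sub_val p.1).
  by apply: (continuous_compose sub_val_continuous); exact: continuous_fst_proj.
have c2 : continuous (fun p : T * T => sub_val p.2).
  by apply: (continuous_compose sub_val_continuous); exact: continuous_snd_proj.
exact: (continuous_mulg c1 c2).
Qed.

HB.instance Definition _ :=
  Semigroup_isTopSemigroup.Build T subsemigroup_mul_continuous.

Definition in_subsemigroup x (Ax : A x) : T := (SigSub (mem_set Ax) : set_type A).

Lemma compact_subsemigroup_type : compact A -> compact [set: T].
Proof. exact: compact_set_type. Qed.

Lemma subsemigroup_hausdorff : hausdorff_space S -> hausdorff_space T.
Proof. exact: embedding_hausdorff sub_val_topological_embedding. Qed.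

End Subsemigroups.

Section CliffordInverse.
Local Open Scope group_scope.
Variable S : topSemigroupType.

(** A chosen inversion bundled with the hypotheses on [S]; [cinv_comm] is the form in which the
    Clifford property is used. *)
Record clifford_inverse := {
  cinv :> S -> S;
  cinvP : forall x, inverse_of x (cinv x);
  cinv_uniq : forall x y, inverse_of x y -> y = cinv x;
  cinv_comm : forall x, x * cinv x = cinv x * x;
  cinv_continuous : continuous cinv;
  cinv_hausdorff : hausdorff_space S;
  cinv_compact : compact [set: S]
}.

Lemma clifford_inverse_exists : hausdorff_space S -> compact [set: S] -> clifford S ->
  topological_inverse S -> exists _ : clifford_inverse, True.
Proof.
move=> hS cS clS [invS [inv invP invc]].
have uniq x y : inverse_of x y -> y = inv x.
  move=> xy; have [z [_ zu]] := invS x.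
  by rewrite -(zu _ xy) -(zu _ (invP x)).
have comm x : x * inv x = inv x * x.
  have [A gA Ax] := clS x; have [e [y [xy _ xye yxe _]]] := subgroup_inverse gA Ax.
  by rewrite -(uniq _ _ xy) xye yxe.
by exists (Build_clifford_inverse invP uniq comm invc hS cS).
Qed.

Variable inv : clifford_inverse.
Implicit Types (x y e f : S).

Lemma cinv_idem e : e * e = e -> inv e = e.
Proof. by move=> ee; rewrite -(cinv_uniq inv (y := e)) //; split; rewrite !ee. Qed.

Lemma cinvK x : inv (inv x) = x.
Proof. by have [? ?] := cinvP inv x; rewrite -(cinv_uniq inv (y := x)). Qed.

(** If [y] is the inverse of [a b], so is [b y a]; uniqueness gives [y = b y a], whence [y] and
    therefore [a b] is idempotent. Then [f e] is an inverse of the idempotent [e f], hence equal to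
    it. *)
Lemma idem_comm e f : e * e = e -> f * f = f -> e * f = f * e.
Proof.
have idem (a b : S) : a * a = a -> b * b = b -> (a * b) * (a * b) = a * b.
  move=> aa bb; have [xyx yxy] := cinvP inv (a * b); set y := inv (a * b) in xyx yxy.
  have yE : b * y * a = y.
    apply: (cinv_uniq inv); split.
      have -> : a * b * (b * y * a) * (a * b) = a * (b * b) * y * (a * a) * b by rewrite !mulgA.
      by rewrite aa bb -[RHS]xyx !mulgA.
    have -> : b * y * a * (a * b) * (b * y * a) = b * (y * (a * a) * (b * b) * y) * a.
      by rewrite !mulgA.
    by rewrite aa bb -(mulgA y a b) yxy.
  have yy : y * y = y.
    transitivity ((b * y * a) * (b * y * a)); first by rewrite yE.
    have -> : b * y * a * (b * y * a) = b * (y * (a * b) * y) * a by rewrite !mulgA.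
    by rewrite yxy yE.
  by rewrite -[a * b]cinvK -/y (cinv_idem yy) yy.
move=> ee ff; have efI := idem _ _ ee ff; have feI := idem _ _ ff ee.
rewrite -[LHS](cinv_idem efI); symmetry; apply: (cinv_uniq inv); split.
  have -> : e * f * (f * e) * (e * f) = e * (f * f) * ((e * e) * f) by rewrite !mulgA.
  by rewrite ee ff efI.
have -> : f * e * (e * f) * (f * e) = f * (e * e) * ((f * f) * e) by rewrite !mulgA.
by rewrite ee ff feI.
Qed.

Definition unit_of x := x * inv x.

Lemma unit_of_idem x : unit_of x * unit_of x = unit_of x.
Proof. by have [xyx _] := cinvP inv x; rewrite /unit_of mulgA xyx. Qed.

Lemma unit_of_mul x : unit_of x * x = x.
Proof. by have [] := cinvP inv x. Qed.

Lemma mul_unit_of x : x * unit_of x = x.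
Proof. by rewrite /unit_of cinv_comm mulgA unit_of_mul. Qed.

Lemma inv_unit_of x : inv x * unit_of x = inv x.
Proof. by have [_] := cinvP inv x; rewrite -mulgA. Qed.

Lemma unit_of_inv x : unit_of (inv x) = unit_of x.
Proof. by rewrite /unit_of cinvK cinv_comm. Qed.

Lemma unit_of_id e : e * e = e -> unit_of e = e.
Proof. by move=> ee; rewrite /unit_of cinv_idem. Qed.

(** The element [e x] commutes with its inverse [i e]; the two products are [u e] and [i e x], and
    multiplying them by [x] on the left gives [x e] and [e x]. *)
Lemma idem_central e x : e * e = e -> e * x = x * e.
Proof.
move=> ee; set u := unit_of x; set i := inv x.
have eu : e * u = u * e by exact: idem_comm ee (unit_of_idem x).
have eue : e * u * e = u * e by rewrite eu -mulgA ee.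
have invex : i * e = inv (e * x).
  apply: (cinv_uniq inv); split.
    have -> : e * x * (i * e) * (e * x) = e * (x * i) * (e * e) * x by rewrite !mulgA.
    by rewrite ee -/(unit_of x) -/u eue -eu -mulgA unit_of_mul.
  have -> : i * e * (e * x) * (i * e) = i * ((e * e) * (x * i) * e) by rewrite !mulgA.
  by rewrite ee -/(unit_of x) -/u eue mulgA inv_unit_of.
have := cinv_comm inv (e * x); rewrite -invex.
have -> : e * x * (i * e) = e * u * e by rewrite /u /unit_of -/i !mulgA.
have -> : i * e * (e * x) = i * (e * e) * x by rewrite !mulgA.
rewrite eue ee => key.
transitivity (x * (i * e * x)); last by rewrite -key mulgA mul_unit_of.
have -> : x * (i * e * x) = u * e * x by rewrite /u /unit_of -/i !mulgA.
by rewrite -eu -mulgA unit_of_mul.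
Qed.

Lemma unit_ofM x y : unit_of (x * y) = unit_of x * unit_of y.
Proof.
set u := unit_of x; set v := unit_of y; set i := inv x; set j := inv y.
have uI : u * u = u by exact: unit_of_idem.
have vI : v * v = v by exact: unit_of_idem.
have ix : i * x = u by rewrite /i -cinv_comm.
have invxy : j * i = inv (x * y).
  apply: (cinv_uniq inv); split.
    have -> : x * y * (j * i) * (x * y) = x * (v * (i * x)) * y by rewrite /v /unit_of -/j !mulgA.
    by rewrite ix (idem_comm vI uI) mulgA mul_unit_of -mulgA unit_of_mul.
  have -> : j * i * (x * y) * (j * i) = j * ((i * x) * v) * i by rewrite /v /unit_of -/j !mulgA.
  rewrite ix (idem_comm uI vI) mulgA inv_unit_of -mulgA (idem_central _ uI).
  by rewrite inv_unit_of.
have -> : unit_of (x * y) = x * (v * i) by rewrite /unit_of -invxy /v /unit_of -/j !mulgA.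
by rewrite (idem_central _ vI) mulgA.
Qed.

Lemma unit_of_continuous : continuous unit_of.
Proof.
have ic := @cinv_continuous inv; have idc : continuous (fun x : S => x) by cont.
exact: (continuous_mulg idc ic).
Qed.

End CliffordInverse.

Section MaximalSubgroups.
Local Open Scope group_scope.
Variables (S : topSemigroupType) (inv : clifford_inverse S) (c : S) (cc : c * c = c).

Definition maximal_subgroup : set S := [set s | unit_of inv s = c].

Lemma maximal_subgroup_mul : subsemigroup maximal_subgroup.
Proof. by move=> x y xc yc; rewrite /maximal_subgroup /= unit_ofM xc yc cc. Qed.

Definition maxgroup : Type := let _ := cc in subsemigroup_type maximal_subgroup_mul.
Local Notation T := maxgroup.

HB.instance Definition _ := TopSemigroup.copy T (subsemigroup_type maximal_subgroup_mul).

Definition maxgroup_val (x : T) : S := sub_val (x : subsemigroup_type maximal_subgroup_mul).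

Lemma maxgroup_valP x : unit_of inv (maxgroup_val x) = c.
Proof. exact: (sub_valP (x : subsemigroup_type maximal_subgroup_mul)). Qed.

Definition in_maxgroup (s : S) (sc : unit_of inv s = c) : T :=
  in_subsemigroup maximal_subgroup_mul sc.

Lemma maxgroup_val_inj : injective maxgroup_val.
Proof. exact: sub_val_inj. Qed.

Lemma maxgroup_valM (x y : T) : maxgroup_val (x * y) = maxgroup_val x * maxgroup_val y.
Proof. by []. Qed.

Definition maxgroup_one : T := in_maxgroup (unit_of_id inv cc).

Definition maxgroup_inv (x : T) : T :=
  in_maxgroup (etrans (unit_of_inv inv (maxgroup_val x)) (maxgroup_valP x)).

Lemma maxgroup_mul1 : left_id maxgroup_one *%g.
Proof.
move=> x; apply: maxgroup_val_inj; rewrite maxgroup_valM.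
by rewrite -[RHS](unit_of_mul inv) maxgroup_valP.
Qed.

Lemma maxgroup_mulr1 : right_id maxgroup_one *%g.
Proof.
move=> x; apply: maxgroup_val_inj; rewrite maxgroup_valM.
by rewrite -[RHS](mul_unit_of inv) maxgroup_valP.
Qed.

HB.instance Definition _ := Semigroup_isMonoid.Build T maxgroup_mul1 maxgroup_mulr1.
HB.instance Definition _ := hasInv.Build T maxgroup_inv.

Lemma maxgroup_mulVg : left_inverse 1 (@monoid.inv T) *%g.
Proof.
move=> x; apply: maxgroup_val_inj; rewrite maxgroup_valM -[RHS](maxgroup_valP x).
exact/esym/cinv_comm.
Qed.

Lemma maxgroup_mulgV : right_inverse 1 (@monoid.inv T) *%g.
Proof.
by move=> x; apply: maxgroup_val_inj; rewrite maxgroup_valM -[RHS](maxgroup_valP x).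
Qed.

HB.instance Definition _ := Monoid_isGroup.Build T maxgroup_mulVg maxgroup_mulgV.

Lemma maxgroup_val_continuous : continuous maxgroup_val.
Proof. exact: sub_val_continuous. Qed.

Lemma maxgroup_inv_continuous : continuous (fun x : T => x^-1).
Proof.
apply: (@continuous_set_type _ _ maximal_subgroup).
exact: (continuous_compose (@cinv_continuous S inv) maxgroup_val_continuous).
Qed.

Lemma maxgroup_hausdorff : hausdorff_space T.
Proof. apply: subsemigroup_hausdorff; exact: cinv_hausdorff inv. Qed.

Lemma maxgroup_compact : compact [set: T].
Proof.
apply: compact_subsemigroup_type; apply: (subclosed_compact _ (cinv_compact inv)) => //.
apply: closed_eq_fun; [exact: cinv_hausdorff inv|exact: unit_of_continuous|].
exact: cst_continuous.
Qed.

(** Compact Hausdorff spaces are normal, which supplies the complete regularity demanded of a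
    topological group. *)
Lemma maxgroup_completely_regular : completely_regular_space T.
Proof.
apply: (@normal_completely_regular Rdefinitions.R).
  by apply: compact_normal; [exact: maxgroup_hausdorff|exact: maxgroup_compact].
by apply: hausdorff_accessible; exact: maxgroup_hausdorff.
Qed.

HB.instance Definition _ := TopSemigroup_isTopGroup.Build T
  maxgroup_inv_continuous maxgroup_completely_regular maxgroup_hausdorff.

End MaximalSubgroups.

(** * Embedding tools for the cover *)

Section Embeddings.
Local Open Scope group_scope.

Lemma singleton_nonempty_compact (G : topGroupType) (x : G) : nonempty_compacts [set x].
Proof. by split; [exists x|exact: compact_set1]. Qed.

Definition hsingleton (G : topGroupType) (x : G) : hyperspace G :=
  SigSub (mem_set (singleton_nonempty_compact x)) : set_type (@nonempty_compacts G).

Lemma topgroup_class_H (G : topGroupType) : class_H G.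
Proof.
exists G, (@hsingleton G).
  move=> x y; apply: hset_inj; rewrite hset_mul eqEsubset.
  by split=> [_ ->|_ [_ -> [_ -> <-]]] //; exists x => //; exists y.
have single (x : G) (U : set G) : U x -> hset (hsingleton x) `<=` U by move=> Ux _ ->.
split=> [x y /(congr1 (@hset G)) xy|U].
  by have : hset (hsingleton y) x by rewrite -xy.
split=> [oU|[V oV ->]].
  exists (vietoris_upper U); first by apply: vietoris_openP; left; exists U.
  by rewrite eqEsubset; split=> x; [exact: single|apply].
apply: open_comp => // x _; apply: vietoris_continuous => {}x _ [[W oW <-]|[W oW <-]].
  move=> /(_ x erefl) Wx; apply: filterS (open_nbhs_nbhs (conj oW Wx)) => y.
  exact: single.
move=> [_ [-> Wx]]; apply: filterS (open_nbhs_nbhs (conj oW Wx)) => y Wy.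
by exists y.
Qed.

Lemma attach_zero_compact (T : topSemigroupType) :
  compact [set: T] -> compact [set: attach_zero T].
Proof.
move=> cT; have -> : [set: attach_zero T] = range Some `|` [set None].
  rewrite eqEsubset; split=> [[t|] _|//]; last by right.
  by left; exists t.
apply: compactU; last exact: compact_set1.
apply: continuous_compact => //; apply: continuous_subspaceT; exact: some_continuous.
Qed.

Lemma compact_injective_embedding (X Y : topologicalType) (f : X -> Y) :
  compact [set: X] -> hausdorff_space Y -> continuous f -> injective f ->
  topological_embedding f.
Proof.
move=> cX hY fc fI; split=> // U; split=> [oU|[V oV ->]]; last by apply: open_comp.
exists (~` (f @` (~` U))).
  apply: closed_openC; apply: compact_closed => //.
  apply: continuous_compact; first exact: continuous_subspaceT.
  by apply: (subclosed_compact _ cX) => //; exact: open_closedC.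
rewrite eqEsubset; split=> x; first by move=> Ux [y nUy /fI yx]; apply: nUy; rewrite yx.
by move=> nfx; apply: contrapT => nUx; apply: nfx; exists x.
Qed.

Lemma continuous_into_prod (X : topologicalType) (I : Type) (S : I -> topSemigroupType)
    (f : X -> prod_topology S) :
  (forall i, continuous (fun x => f x i)) -> continuous f.
Proof.
move=> fc x; apply/cvg_sup => i A [_ [[B oB <-] Bx] BA].
have : nbhs x [set y | B (f y i)].
  by apply: (fc i x); apply: open_nbhs_nbhs.
by apply: filterS => y By; apply: BA.
Qed.

(** The subgroup around [x] is the group of units of the local monoid at [e]. *)
Lemma clifford_of_inverses (S : topSemigroupType) :
  (forall x : S, exists e y, [/\ e * x = x, x * e = x, x * y = e, y * x = e &
    e * y = y /\ y * e = y]) -> clifford S.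
Proof.
move=> inv x; have [e [y [ex xe xy yx [ey ye]]]] := inv x.
have ee : e * e = e by rewrite -{2}xy mulgA ex.
exists [set z | e * z = z /\ z * e = z /\ exists w, [/\ e * w = w, w * e = w, z * w = e & w * z = e]].
  split.
    move=> z z' [ez [ze [w [ew we zw wz]]]] [ez' [z'e [w' [ew' w'e zw' wz']]]].
    split; first by rewrite mulgA ez.
    split; first by rewrite -mulgA z'e.
    exists (w' * w); split.
    - by rewrite mulgA ew'.
    - by rewrite -mulgA we.
    - by rewrite -mulgA (mulgA z') zw' ew zw.
    - by rewrite -mulgA (mulgA w) wz ez' wz'.
  exists e; split.
  - by split=> //; split=> //; exists e.
  - by move=> z [ez [ze _]].
  - move=> z [ez [ze [w [ew we zw wz]]]]; exists w; split=> //.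
    by split=> //; split=> //; exists z.
by split=> //; split=> //; exists y.
Qed.

End Embeddings.

(** * Compact Lawson semilattices are continuous *)

Section LawsonContinuous.
Local Open Scope group_scope.
Variables (S : topSemigroupType) (E : set S).

Lemma lawson_base : lawson E -> forall y V, E y -> nbhs y V ->
  exists A, [/\ A `<=` E `&` V, A y, subsemigroup A & relatively_open E A].
Proof.
move=> [_ lE] y V Ey yV; pose u : E := SigSub (mem_set Ey).
have uV : nbhs u (set_val @^-1` V).
  have cv := embedding_continuous (@set_val_embedding S E).
  have yV' : nbhs (set_val u) V by [].
  exact: (cv u _ yV').
have [B [[oB BM] Bu] BV] := lE u _ uV.
exists (set_val @` B); split=> //.
- by move=> _ [v Bv <-]; split; [exact: set_valP|exact: BV].
- by exists u.
move=> _ [v Bv <-]; have [W oW WB] := oB.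
have Wv : W (set_val v) by rewrite -[W _]/((set_val @^-1` W) v) WB.
apply: filterS (open_nbhs_nbhs (conj oW Wv)) => x Wx Ex.
by exists (SigSub (mem_set Ex) : E) => //; rewrite -WB.
Qed.

(** The witness is the minimum of the closure of an open subsemilattice around [y], chosen so small
    that its closure misses the compact set of elements below [w]. *)
Lemma lawson_continuous_semilattice : hausdorff_space S -> compact E ->
  subsemilattice E -> lawson E -> continuous_semilattice E.
Proof.
move=> hS cE lE lawE y w Ey Ew yw; have [Ei Ec EM] := lE.
pose C := E `&` [set t | t * w = t].
have cC : compact C.
  by apply: compact_closedI => //; apply: closed_eq_fun => //; cont.
have [|V [W [yV oW CW VW]]] := hausdorff_compact_disjoint_nbhs (x := y) hS cC.
  by case.
have [A [AEV Ay AM Ao]] := lawson_base lawE Ey yV.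
have clAE : closure A `<=` E.
  rewrite (closure_id E).1; first by apply: closureS => x /AEV[].
  exact: compact_closed.
have lA : subsemilattice (closure A).
  split; [by move=> x /clAE/Ei|by move=> x x' /clAE Ex /clAE; exact: Ec|].
  exact: closure_subsemigroup.
have cA : compact (closure A).
  by apply: (subclosed_compact _ cE) => //; exact: closed_closure.
have [z Az zA] := compact_semilattice_min hS cA lA (ex_intro _ y (subset_closure Ay)).
have Ez := clAE _ Az.
exists z.
  split=> //; apply: filterS (Ao _ Ay) => x AEx Ex; apply: zA; apply: subset_closure.
  exact: AEx.
move=> zw; have [x [Ax Wx]] := Az W (open_nbhs_nbhs (conj oW (CW z (conj Ez zw)))).
by have [_ Vx] := AEV _ Ax; exact: (VW x).
Qed.

End LawsonContinuous.

(** * The cover of a Lawson Clifford semigroup *)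

Section Backward.
Local Open Scope group_scope.
Variables (S : topSemigroupType) (inv : clifford_inverse S).
Hypothesis lawS : lawson (idempotents S).
Let E : set S := idempotents S.
Let hS : hausdorff_space S := cinv_hausdorff inv.
Let I : Type := set_type E.
Let e : S -> S := unit_of inv.

Let Ei (c : I) : set_val c * set_val c = set_val c.
Proof. by have : E (set_val c) by exact: set_valP. Qed.

Let lE : subsemilattice E.
Proof. by apply: idempotents_subsemilattice; exact: (idem_comm inv). Qed.

Let cE : compact E.
Proof. by apply: idempotents_compact => //; exact: cinv_compact inv. Qed.

Let ctsE : continuous_semilattice E.
Proof. exact: lawson_continuous_semilattice. Qed.

Let Ee s : E (e s).
Proof. exact: unit_of_idem. Qed.

Let H (c : I) : topGroupType := maxgroup inv (Ei c).
Let H0 (c : I) : topSemigroupType := attach_zero (H c).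
(** The coordinate [None] keeps [s] itself; it provides the map onto [S] and is dropped in the
    embedding into groups with zero. *)
Let F (i : option I) : topSemigroupType := if i is Some c then H0 c else S.
Let P : topSemigroupType := prod_topology F.

(* A point of [P] records an element [s] of [S] together with the set of those
   idempotents [c] whose coordinate is not the zero. It lies in the cover when this
   set contains every [c] way below [s s^-1], is bounded by [s s^-1], and the
   corresponding coordinates are the products [c s]. *)
Definition lawson_cover : set P := [set x : P | forall c : I,
  (forall h : H c, x (Some c) = Some h -> maxgroup_val h = set_val c * x None) /\
  (way_below E (set_val c) (e (x None)) -> x (Some c) <> None)].

Let proj_cont i : continuous (fun x : P => x i).
Proof. exact: prod_proj_continuous. Qed.

Lemma lawson_cover_mul : subsemigroup lawson_cover.
Proof.
have [Ei' Ec EM] := lE.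
(* An idempotent way below the unit of a product is way below the unit of each factor, so neither
   factor has a zero at that coordinate. *)
have wbl c s t : way_below E c (e (s * t)) -> way_below E c (e s).
  move=> [Ec' cst]; split=> //; have ct : continuous (fun y => y * e t) by cont.
  have cst' : nbhs (e s * e t) [set x | E x -> c * x = c] by rewrite -unit_ofM.
  have : nbhs (e s) [set y | E (y * e t) -> c * (y * e t) = c] by exact: (ct (e s) _ cst').
  apply: filterS => y cy Ey; apply: (mul_le_mul lE Ec' Ey (Ee t)).
  by apply: cy; exact: EM.
have wbr c s t : way_below E c (e (s * t)) -> way_below E c (e t).
  by rewrite /e unit_ofM (idem_comm inv (Ee s) (Ee t)) -unit_ofM; exact: wbl.
move=> x y Px Py c; have [xc xw] := Px c; have [yc yw] := Py c.
have -> : (x * y : P) (Some c) = zero_mul (x (Some c)) (y (Some c)) by [].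
split.
  move=> h.
  case xE : (x (Some c)) xc => [u|//] xc; case yE : (y (Some c)) yc => [v|//] yc [<-].
  rewrite (maxgroup_valM u v) (xc u)// (yc v)//.
  rewrite [RHS]/(_ * (x None * y None)) !mulgA -(mulgA _ (x None)).
  rewrite -(idem_central inv (x None) (Ei c)) (mulgA _ (set_val c)) (Ei c).
  by rewrite -mulgA.
move=> cxy; have {}cxy : way_below E (set_val c) (e (x None * y None)) by exact: cxy.
have := xw (wbl _ _ _ cxy); have := yw (wbr _ _ _ cxy).
by case: (x (Some c)) => // u; case: (y (Some c)).
Qed.

(** Both conditions are closed: the zero is isolated, and for fixed [c] being way below is an open
    condition on the unit. *)
Lemma lawson_cover_closed : closed lawson_cover.
Proof.
move=> x clx c; split.
  move=> h xh; apply: contrapT => hx.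
  have [A [B [hA cB AB]]] := hausdorff_disjoint_nbhs hS hx.
  pose A' : set (H0 c) := Some @` (@maxgroup_val S inv (set_val c) (Ei c) @^-1` A).
  have nA' : nbhs (x (Some c) : H0 c) A'.
    rewrite xh; apply: attach_zero_nbhs_some.
    exact: (@maxgroup_val_continuous S inv _ (Ei c) h _ hA).
  have nA : nbhs x [set y : P | A' (y (Some c))] by exact: (@proj_cont (Some c) x _ nA').
  have nB : nbhs x [set y : P | B (set_val c * y None)].
    have cc : continuous (fun s : S => set_val c * s) by cont.
    exact: (continuous_compose cc (@proj_cont None) cB).
  have [y [Py [[u Au uy] By]]] := clx _ (filterI nA nB).
  by have [yc _] := Py c; apply: (AB (maxgroup_val u)) => //; rewrite (yc u).
move=> [_ /nbhs_interior cx] x0.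
have n0' : nbhs (x (Some c) : H0 c) [set None] by rewrite x0; exact: attach_zero_nbhs_none.
have n0 : nbhs x [set y : P | [set None] (y (Some c) : H0 c)].
  exact: (@proj_cont (Some c) x _ n0').
have ec : continuous (fun y : P => e (y None)).
  exact: (continuous_compose (@unit_of_continuous S inv) (@proj_cont None)).
have nw : nbhs x [set y : P | interior [set x | E x -> set_val c * x = set_val c] (e (y None))].
  exact: (ec x _ cx).
have [y [Py [y0 yw]]] := clx _ (filterI n0 nw).
by have [_ yc] := Py c; apply: yc y0; split=> //; exact: set_valP.
Qed.

Let T : topSemigroupType := subsemigroup_type lawson_cover_mul.

Let val_T : T -> P := @sub_val P lawson_cover lawson_cover_mul.

Lemma lawson_cover_compact : compact [set: T].
Proof.
apply: compact_subsemigroup_type; apply: (subclosed_compact lawson_cover_closed (B := [set: P])) => //.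
have cF (i : option I) : compact [set: F i].
  case: i => [c|]; last exact: cinv_compact inv.
  by apply: attach_zero_compact; exact: maxgroup_compact.
have -> : [set: P] = [set f : forall i, F i | forall i, [set: F i] (f i)].
  by rewrite eqEsubset; split.
exact: (@tychonoff (option I) F (fun i => [set: F i]) cF).
Qed.

Let val_T_inj : injective val_T.
Proof. exact: sub_val_inj. Qed.

Let val_TP (t : T) : lawson_cover (val_T t).
Proof. exact: sub_valP. Qed.

Let in_T x (Px : lawson_cover x) : T := in_subsemigroup lawson_cover_mul Px.

Lemma lawson_cover_image : continuous_hom_image T S.
Proof.
exists (fun t => val_T t None); split.
- by [].
- apply: (continuous_compose (@proj_cont None)).
  exact: (@sub_val_continuous P lawson_cover lawson_cover_mul).
rewrite eqEsubset; split=> // s _.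
have ecs (c : I) : set_val c * e s = set_val c -> unit_of inv (set_val c * s) = set_val c.
  by move=> ces; rewrite unit_ofM (unit_of_id inv (Ei c)).
(* Every [c] below the unit of [s] gets a nonzero coordinate, the largest choice allowed. *)
pose x : P := fun i => match i return F i with
  | None => s
  | Some c => if pselect (set_val c * e s = set_val c) is left ces
              then Some (in_maxgroup (Ei c) (ecs c ces)) else None
  end.
have Px : lawson_cover x.
  move=> c; split; rewrite /x; case: pselect => //.
    by move=> ces h [<-].
  by move=> nces cs; case: nces; exact: (way_below_le (Ee s) cs).
by exists (in_T Px).
Qed.

Lemma lawson_cover_clifford : clifford T.
Proof.
apply: clifford_of_inverses => t.
pose x := val_T t.
pose y : P := fun i => match i return F i with
  | None => inv (x None)
  | Some c => if x (Some c) is Some h then Some (monoid.inv (h : H c)) else None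
  end.
have Py : lawson_cover y.
  move=> c; have [xc xw] := val_TP t c; split; rewrite -/x in xc xw.
    move=> h; rewrite /y; case xE : (x (Some c)) => [u|//] [<-].
    rewrite -[LHS]/(inv (maxgroup_val u)) (xc u)//.
    symmetry; apply: (cinv_uniq inv).
    have [xyx yxy] := cinvP inv (x None).
    have cen z := idem_central inv z (Ei c).
    have ccc : set_val c * set_val c = set_val c by exact: Ei.
    split.
      rewrite -!mulgA (mulgA (x None) (set_val c)) -cen -!mulgA.
      rewrite (mulgA (inv _) (set_val c)) -cen -!mulgA !(mulgA (set_val c) (set_val c)) ccc.
      rewrite (mulgA (x None) (set_val c)) -cen -!mulgA !(mulgA (set_val c) (set_val c)) ccc.
      by rewrite (mulgA (x None)) xyx.
    rewrite -!mulgA (mulgA (inv _) (set_val c)) -cen -!mulgA.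
    rewrite (mulgA (x None) (set_val c)) -cen -!mulgA !(mulgA (set_val c) (set_val c)) ccc.
    rewrite (mulgA (inv _) (set_val c)) -cen -!mulgA !(mulgA (set_val c) (set_val c)) ccc.
    by rewrite (mulgA (inv _)) yxy.
  rewrite /y -[e _]/(unit_of inv (inv (x None))) unit_of_inv => /xw.
  by case: (x (Some c)).
pose u := in_T Py; exists (t * u), u.
have ext (a b : T) : (forall i, val_T a i = val_T b i) -> a = b.
  by move=> ab; apply: val_T_inj; apply: functional_extensionality_dep.
have ME (a b : T) i : val_T (a * b) i = val_T a i * val_T b i by [].
have uE i : val_T u i = y i by [].
split; [| | by [] | | split]; apply: ext => -[c|]; rewrite !ME !uE -/x /y.
- case: (x (Some c)) => // h; congr Some.
  by rewrite -[LHS]/(h * h^-1 * h) mulgVK.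
- by have [] := cinvP inv (x None).
- case: (x (Some c)) => // h; congr Some.
  by rewrite -[LHS]/(h * (h * h^-1)) mulgV mulg1.
- exact: (mul_unit_of inv).
- case: (x (Some c)) => // h; congr Some.
  by rewrite -[LHS]/(h^-1 * h) -[RHS]/(h * h^-1) mulgV mulVg.
- exact/esym/cinv_comm.
- case: (x (Some c)) => // h; congr Some.
  by rewrite -[LHS]/(h * h^-1 * h^-1) mulgV mul1g.
- by rewrite -[LHS]/(unit_of inv (x None) * inv (x None)) -{1}(unit_of_inv inv (x None)) unit_of_mul.
- case: (x (Some c)) => // h; congr Some.
  by rewrite -[LHS]/(h^-1 * (h * h^-1)) mulgV mulg1.
- exact: (inv_unit_of inv).
Qed.

(** For injectivity without the coordinate [None]: equal coordinates give [c s = c s'] for all [c]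
    way below the unit of [s], and such [c] lie below the unit of [s']. By continuity of the
    semilattice the units agree, and choosing [c] close to the unit gives [s = s']. *)
Lemma lawson_cover_class_H0 : class_H0 T.
Proof.
apply: (@class_H0_subdirect I H0).
  by move=> c; apply: class_H0_zero; [exact: maxgroup_compact|exact: topgroup_class_H].
exists (fun t c => val_T t (Some c)); first by [].
apply: compact_injective_embedding.
- exact: lawson_cover_compact.
- by apply: prod_hausdorff => c; apply: attach_zero_hausdorff; exact: maxgroup_hausdorff.
- apply: continuous_into_prod => c; apply: (continuous_compose (@proj_cont (Some c))).
  exact: (@sub_val_continuous P lawson_cover lawson_cover_mul).
move=> t t' tt'; have tc c : val_T t (Some c) = val_T t' (Some c).
  by rewrite -[LHS]/((fun c => val_T t (Some c)) c) tt'.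
pose s := val_T t None; pose s' := val_T t' None.
have wb (a b : T) (c : S) : (forall c, val_T a (Some c) = val_T b (Some c)) ->
    way_below E c (e (val_T a None)) -> c * val_T a None = c * val_T b None /\ c * e (val_T b None) = c.
  move=> ab cwb; have [Ec _] := cwb; pose i : I := SigSub (mem_set Ec).
  have [ac aw] := val_TP a i; have [bc _] := val_TP b i.
  case aE : (val_T a (Some i)) (aw cwb) => [h|//] _.
  have ah := ac h aE; have bh : maxgroup_val h = c * val_T b None by apply: (bc h); rewrite -ab.
  split; first by rewrite -bh.
  have : unit_of inv (maxgroup_val h) = c by exact: maxgroup_valP.
  by rewrite bh unit_ofM (unit_of_id inv Ec).
have le (a b : T) : (forall c, val_T a (Some c) = val_T b (Some c)) ->
    e (val_T a None) * e (val_T b None) = e (val_T a None).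
  move=> ab; apply: contrapT => nle; have [c cwb] := ctsE (Ee _) (Ee _) nle.
  by apply; have [] := wb a b c ab cwb.
have ss' : e s = e s'.
  by rewrite -(le t t' tc) (idem_comm inv (Ee _) (Ee _)) le.
have sE : s = s'.
  apply: contrapT => nss'.
  have cl : continuous (fun c : S => c * s) by cont.
  have cr : continuous (fun c : S => c * s') by cont.
  have near_neq : nbhs (e s) [set c | c * s <> c * s'].
    by apply: (nbhs_neq hS cl cr); rewrite (unit_of_mul inv) ss' (unit_of_mul inv).
  have [c cs] := way_below_nbhs hS cE lE ctsE (Ee s) near_neq.
  by apply; have [] := wb t t' c tc cs.
by apply: val_T_inj; apply: functional_extensionality_dep => -[c|]; [exact: tc|exact: sE].
Qed.

Lemma lawson_clifford_cover : exists S0 : topSemigroupType,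
  [/\ compact [set: S0], clifford S0, class_H0 S0 & continuous_hom_image S0 S].
Proof.
exists T; split; [exact: lawson_cover_compact|exact: lawson_cover_clifford|
  exact: lawson_cover_class_H0|exact: lawson_cover_image].
Qed.

End Backward.

Theorem proposition2 (S : topSemigroupType) (hausdorffS : hausdorff_space S) :
  (exists S0 : topSemigroupType,
     [/\ compact [set: S0], clifford S0, class_H0 S0 &
         continuous_hom_image S0 S])
  <->
  [/\ compact [set: S], clifford S, topological_inverse S &
      lawson (idempotents S)].
Proof.
split=> [[S0 [cS0 clS0 H0 imS]]|[cS clS invS lawS]].
  exact: (compact_clifford_image Rdefinitions.R hausdorffS cS0 clS0 H0 imS).
have [inv _] := clifford_inverse_exists hausdorffS cS clS invS.
exact: lawson_clifford_cover inv lawS.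
Qed.
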